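(* Uniformly in the parameter $c \in \mathrm{CompStr}$, the set $\mathrm{DCL}_0^c$ is the intersection of a $\Pi^0_1$ set and a $\Sigma^0_1$ set (in particular, it is a $\Delta^0_2$ set).
   Context: Languages are relational and may be many-sorted: $\mathcal{L} = ((X_j)_{j\in J}, (R_i)_{i\in I})$ with sorts $X_j$ and relation symbols $R_i$, where $I,J\in\mathbb{N}\cup\{\mathbb{N}\}$ (a natural number is identified with the set of its predecessors). The type of a tuple of elements or variables is the product of the sorts of its entries, in order; the type of a relation symbol is a finite product of sorts. $\mathcal{L}$ is computable when the function sending $i\in I$ to $(j_0,\dots,j_{m-1})$, where $R_i$ has type $\prod_{k<m}X_{j_k}$, is computable; for each computable language a computable encoding of its first-order formulas is fixed. A computable $\mathcal{L}$-structure $\mathcal{N}$ has a computable underlying set, and $\{(a,j) : a\in (X_j)^{\mathcal{N}}\}$ and $\{(\overline{b},i) : \overline{b}\in (R_i)^{\mathcal{N}}\}$ are computable. Writing $\{e\}$ for the $e$th Turing machine, $c\in\mathbb{N}$ is a code for a structure if $\{c\}(0)$ is a code for a computable language, denoted $\mathcal{L}_c$, and $\{c\}(1)$ is a code for a computable $\mathcal{L}_c$-structure, denoted $\mathcal{M}_c$. $\mathrm{CompStr}$ is the set of all codes for structures. $\mathrm{DCL}^c_0$ is the set of pairs $(\varphi(\overline{x};\overline{y}),\overline{a})$ such that $\varphi$ is a quantifier-free first-order $\mathcal{L}_c$-formula with a specified partition $\overline{x};\overline{y}$ of its free variables, $\overline{a}\in\mathcal{M}_c$ has the same type as $\overline{x}$,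 and $\{\overline{b}\in\mathcal{M}_c : \mathcal{M}_c\models\varphi(\overline{a};\overline{b})\}$ is a singleton. ''Uniformly in $c$'' means that the descriptions (indices) of the $\Pi^0_1$ and $\Sigma^0_1$ sets are obtained computably from $c$. *)

(* Defs.v *)
From mathcomp Require Import all_boot.

Set Implicit Arguments.
Unset Strict Implicit.
Unset Printing Implicit Defensive.

(* Finite sequences of naturals are coded by the library's
   bijection CodeSeq.code : seq nat -> nat. *)

Definition cpair (m n : nat) : nat := CodeSeq.code [:: m; n].

(* Deterministic single-tape machines given by a finite list of quintuples.
   States and tape symbols are natural numbers, the blank is 0 and the start
   state is 0; the machine halts when no quintuple applies. *)
Record instr := Instr {
  src : nat; read : nat; dst : nat; write : nat; move_right : bool }.

Definition machine := seq instr.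

(* The tape is infinite in both directions; cells outside the recorded parts
   are blank.  [lpart] is read leftwards from the head, and the scanned cell is
   the first one of [rpart]. *)
Record config := Config { state : nat; lpart : seq nat; rpart : seq nat }.

(* [None] means that the machine halts.  If several quintuples apply, the first
   one in the list is used, so that every list is a deterministic machine. *)
Definition step (M : machine) (cf : config) : option config :=
  let: Config q l r := cf in
  if [seq t <- M | (src t == q) && (read t == head 0 r)] is t :: _ then
    Some (if move_right t then Config (dst t) (write t :: l) (behead r)
          else Config (dst t) (behead l) (head 0 l :: write t :: behead r))
  else None.

(* Input n: a block of n symbols 1, the head scanning the leftmost one.
   Output: the number of symbols 1 on the tape when the machine halts. *)
Definition init (n : nat) : config := Config 0 [::] (nseq n 1).

Definition output (cf : config) : nat :=
  count_mem 1 (lpart cf) + count_mem 1 (rpart cf).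

Definition instr_of_nat (i : nat) : instr :=
  let s := CodeSeq.decode i in
  Instr (nth 0 s 0) (nth 0 s 1) (nth 0 s 2) (nth 0 s 3) (nth 0 s 4 != 0).

(* Every machine is [machine_of_nat e] for some e. *)
Definition machine_of_nat (e : nat) : machine :=
  [seq instr_of_nat i | i <- CodeSeq.decode e].

(* {e}(n) is defined and equal to m. *)
Definition eval (e n m : nat) : Prop :=
  exists (k : nat) (cf : config),
    [/\ iter k (obind (step (machine_of_nat e))) (Some (init n)) = Some cf,
        step (machine_of_nat e) cf = None
      & output cf = m].

Definition computable (f : nat -> nat) : Prop :=
  exists e, forall n, eval e n (f n).

Definition decides (e : nat) (A : nat -> Prop) : Prop :=
  forall n, exists b : bool, eval e n b /\ (A n <-> b).

Definition Sigma01 (e n : nat) : Prop := exists m, eval e n m.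
Definition Pi01 (e n : nat) : Prop := ~ Sigma01 e n.
Definition Sigma02 (e n : nat) : Prop := exists x, Pi01 e (cpair n x).
Definition Pi02 (e n : nat) : Prop := ~ Sigma02 e n.

(* Elements of N u {N}: [Some n] is {0, ..., n - 1} and [None] is N. *)
Definition in_range (K : option nat) (i : nat) : bool :=
  if K is Some n then i < n else true.

(* The sorts are X_j for j in [sort_idx], the relation symbols are R_i for i in
   [rel_idx], and [rel_type i] lists the sorts in the type of R_i; its values
   outside [rel_idx] are irrelevant. *)
Record language := Language {
  sort_idx : option nat;
  rel_idx : option nat;
  rel_type : nat -> seq nat;
  rel_typeP : forall i, in_range rel_idx i ->
    all (in_range sort_idx) (rel_type i) }.

Definition of_type (srt : nat -> nat -> Prop) (b : seq nat) (ts : seq nat) :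
    Prop :=
  size b = size ts /\
  forall k, k < size ts -> srt (nth 0 ts k) (nth 0 b k).

(* [sort j a] means that a belongs to (X_j)^N; every element has exactly one
   sort, so that tuples of elements have a well-defined type. *)
Record structure (L : language) := Structure {
  univ : nat -> Prop;
  sort : nat -> nat -> Prop;
  rel : nat -> seq nat -> Prop;
  sort_in : forall j a, sort j a -> in_range (sort_idx L) j /\ univ a;
  sort_unique : forall a, univ a -> exists! j, sort j a;
  rel_in : forall i b, rel i b ->
    in_range (rel_idx L) i /\ of_type sort b (rel_type L i) }.

(* (j, k) is the k-th variable of sort X_j. *)
Definition var : Type := (nat * nat)%type.

Inductive form : Type :=
| Atom (i : nat) (xs : seq var)
| Equal (x y : var)
| Falsum
| Neg (f : form)
| And (f g : form)
| Or (f g : form)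
| Imp (f g : form)
| All (x : var) (f : form)
| Ex (x : var) (f : form).

Fixpoint wf_form (L : language) (f : form) : bool :=
  match f with
  | Atom i xs => in_range (rel_idx L) i && ([seq x.1 | x <- xs] == rel_type L i)
  | Equal x y => in_range (sort_idx L) x.1 && (x.1 == y.1)
  | Falsum => true
  | Neg f => wf_form L f
  | And f g | Or f g | Imp f g => wf_form L f && wf_form L g
  | All x f | Ex x f => in_range (sort_idx L) x.1 && wf_form L f
  end.

Fixpoint quantifier_free (f : form) : bool :=
  match f with
  | Atom _ _ | Equal _ _ | Falsum => true
  | Neg f => quantifier_free f
  | And f g | Or f g | Imp f g => quantifier_free f && quantifier_free g
  | All _ _ | Ex _ _ => false
  end.

Fixpoint free_vars (f : form) : seq var :=
  match f with
  | Atom _ xs => xs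
  | Equal x y => [:: x; y]
  | Falsum => [::]
  | Neg f => free_vars f
  | And f g | Or f g | Imp f g => free_vars f ++ free_vars g
  | All x f | Ex x f => [seq z <- free_vars f | z != x]
  end.

Fixpoint sat (L : language) (M : structure L) (v : var -> nat) (f : form) :
    Prop :=
  match f with
  | Atom i xs => rel M i [seq v x | x <- xs]
  | Equal x y => v x = v y
  | Falsum => False
  | Neg f => ~ sat M v f
  | And f g => sat M v f /\ sat M v g
  | Or f g => sat M v f \/ sat M v g
  | Imp f g => sat M v f -> sat M v g
  | All x f =>
      forall a, sort M x.1 a -> sat M (fun z => if z == x then a else v z) f
  | Ex x f =>
      exists a, sort M x.1 a /\ sat M (fun z => if z == x then a else v z) f
  end.

Definition assign (xs : seq var) (a : seq nat) (z : var) : nat :=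
  nth 0 a (index z xs).

Definition code_var (x : var) : nat := cpair x.1 x.2.

Definition code_vars (xs : seq var) : nat :=
  CodeSeq.code [seq code_var x | x <- xs].

(* One encoding is used for the formulas of all languages. *)
Fixpoint code_form (f : form) : nat :=
  match f with
  | Atom i xs => CodeSeq.code [:: 0; i; code_vars xs]
  | Equal x y => CodeSeq.code [:: 1; code_var x; code_var y]
  | Falsum => CodeSeq.code [:: 2]
  | Neg f => CodeSeq.code [:: 3; code_form f]
  | And f g => CodeSeq.code [:: 4; code_form f; code_form g]
  | Or f g => CodeSeq.code [:: 5; code_form f; code_form g]
  | Imp f g => CodeSeq.code [:: 6; code_form f; code_form g]
  | All x f => CodeSeq.code [:: 7; code_var x; code_form f]
  | Ex x f => CodeSeq.code [:: 8; code_var x; code_form f]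
  end.

Definition code_range (K : option nat) : nat := if K is Some n then n.+1 else 0.

(* A code for a computable language consists of J, I and an index of the
   function sending i in I to the type of R_i. *)
Definition codes_language (d : nat) (L : language) : Prop :=
  exists t, d = CodeSeq.code
                  [:: code_range (sort_idx L); code_range (rel_idx L); t] /\
    forall i, in_range (rel_idx L) i -> eval t i (CodeSeq.code (rel_type L i)).

(* A code for a computable structure consists of indices of decision procedures
   for the underlying set, the sorts and the relations. *)
Definition codes_computable_structure (d : nat) (L : language)
    (M : structure L) : Prop :=
  exists u s r, [/\ d = CodeSeq.code [:: u; s; r],
    decides u (univ M),
    decides s (fun n => exists a j, n = cpair a j /\ sort M j a)
  & decides r (fun n => exists b i, n = cpair (CodeSeq.code b) i /\ rel M i b)].

(* c is a code for a structure, with L_c = L and M_c = M. *)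
Definition codes_structure (c : nat) (L : language) (M : structure L) : Prop :=
  exists l m, [/\ eval c 0 l, codes_language l L,
                  eval c 1 m & codes_computable_structure m M].

Definition CompStr (c : nat) : Prop :=
  exists (L : language) (M : structure L), codes_structure c M.

(* xs and ys partition the free variables of f, the tuple a has the type of xs,
   and exactly one tuple b of the type of ys satisfies f(a; b) in M. *)
Definition dcl_pair (L : language) (M : structure L)
    (f : form) (xs ys : seq var) (a : seq nat) : Prop :=
  [/\ wf_form L f /\ quantifier_free f,
      uniq (xs ++ ys) /\ xs ++ ys =i free_vars f,
      of_type (sort M) a [seq x.1 | x <- xs]
    & exists! b, of_type (sort M) b [seq y.1 | y <- ys] /\
                 sat M (assign (xs ++ ys) (a ++ b)) f].

(* L_c and M_c are determined by c up to the irrelevant values of [rel_type]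
   and extensional equality of predicates, so for c in CompStr the existential
   quantifier below only names them. *)
Definition DCL0 (c n : nat) : Prop :=
  exists (L : language) (M : structure L), codes_structure c M /\
  exists f xs ys a,
    n = CodeSeq.code [:: code_form f; code_vars xs; code_vars ys;
                         CodeSeq.code a] /\
    dcl_pair M f xs ys a.

(* Main.v *)
Require Import Defs.
From mathcomp Require Import all_boot zify.
From Stdlib Require Import Classical_Prop.

(** Fix a code c of a structure.  A triple of a quantifier-free formula f, a
    partition xs; ys of its variables and a tuple a belongs to the set exactly
    when some tuple b satisfies f(a; b) and no two distinct tuples do.  Truth of
    a quantifier-free formula at given elements is decided by finitely many
    calls to the decision procedures of the structure, and so is the
    well-formedness of f and the typing of the tuples.  Hence the relation
    `the computations started from c on n and b are finished after k steps and
    show that b solves n' is decidable in (c, n, k, b); this is [solution].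
    Searching for (k, b) is the Sigma_1 condition, failing to find
    (k, b, b') with b <> b' both solutions is the Pi_1 condition.  The Sigma_2
    and Pi_2 descriptions are obtained from the two decidable tests.  A triple
    belongs to the set when some number passes the first test and none the second,
    an existential quantifier over a Pi_1 condition, and the complement has
    the same form: either nothing passes the first test, or some number passes
    the second.

    The work lies in showing that these tests, and the dependence of the
    indices on c, are computable by the concrete Turing machines.  Since
    sequence coding is a bijection between naturals and finite lists of
    naturals, every natural is a nested list; the class [PR] of functions built
    from cons, head, tail, successor, composition and iteration consists of the
    unary primitive recursive functions.  Such functions are computed by while
    programs on registers ([PR_cmd]); a while program runs on a tape whose j-th
    cell records, as a vector of bits, which registers exceed j
    ([cmd_correct]).  In this coding the unary input block of length n is
    already the configuration in which register 0 contains n, and the output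
    convention reads register 0.  The parameter c is passed to the machine by c
    additional instructions that write c cells in front of the input; the code of
    this instruction list is primitive recursive in c, which gives the search
    theorem [PR_search].  On the other side, [value] simulates k steps of a
    machine given by its code, and [truth] evaluates codes of formulas by
    course-of-values recursion; both are in [PR].  Evaluation is strict: an
    unfinished computation anywhere gives the value 0, so a nonzero value is
    correct at every stage and appears at all late stages. *)

Set Implicit Arguments.
Unset Strict Implicit.
Unset Printing Implicit Defensive.

Notation code := CodeSeq.code.
Notation decode := CodeSeq.decode.
Notation arg z i := (nth 0 (decode z) i).

Arguments CodeSeq.code : simpl never.
Arguments CodeSeq.decode : simpl never.

(** * Naturals as nested lists *)

(** Adding a first entry to a coded list; on codes this is an arithmetic
    operation, which a register program can carry out by repeated doubling. *)
Definition consn (a m : nat) : nat := 2 ^ a * m.*2.+1.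
Definition hd (x : nat) : nat := head 0 (decode x).
Definition tl (x : nat) : nat := code (behead (decode x)).

Arguments consn : simpl never.

Lemma code_cons a s : code (a :: s) = consn a (code s).
Proof. by []. Qed.

Lemma decode_consn a m : decode (consn a m) = a :: decode m.
Proof. by rewrite -{1}(CodeSeq.decodeK m) -code_cons CodeSeq.codeK. Qed.

Lemma hd_consn a m : hd (consn a m) = a.
Proof. by rewrite /hd decode_consn. Qed.

Lemma tl_consn a m : tl (consn a m) = m.
Proof. by rewrite /tl decode_consn /= CodeSeq.decodeK. Qed.

Lemma hd_code s : hd (code s) = head 0 s.
Proof. by rewrite /hd CodeSeq.codeK. Qed.

Lemma tl_code s : tl (code s) = code (behead s).
Proof. by rewrite /tl CodeSeq.codeK. Qed.

Lemma consn_hd_tl x : 0 < x -> x = consn (hd x) (tl x).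
Proof.
move=> x0; rewrite /hd /tl -code_cons -{1}(CodeSeq.decodeK x).
by case: (decode x) (CodeSeq.decodeK x) => //= x00; rewrite -x00 in x0.
Qed.

Lemma consn_gt0 a m : 0 < consn a m.
Proof. by rewrite muln_gt0 expn_gt0. Qed.

(** * While programs on registers *)

Inductive cmd : Type :=
| Inc (i : nat)
| Dec (i : nat)
| Seq (c d : cmd)
| While (i : nat) (c : cmd).

Notation "c ;; d" := (Seq c d) (at level 60, right associativity).

(** Register contents are functions; every rule accepts any pointwise equal
    result, so that executions transfer along pointwise equality. *)
Inductive exec : cmd -> (nat -> nat) -> (nat -> nat) -> Prop :=
| ExecInc i s s' : s' =1 (fun j => s j + (j == i)) -> exec (Inc i) s s'
| ExecDec i s s' : s' =1 (fun j => s j - (j == i)) -> exec (Dec i) s s'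
| ExecSeq c d s s1 s' : exec c s s1 -> exec d s1 s' -> exec (c ;; d) s s'
| ExecExit i c s s' : s i = 0 -> s' =1 s -> exec (While i c) s s'
| ExecLoop i c s s1 s' : s i != 0 -> exec c s s1 -> exec (While i c) s1 s' ->
    exec (While i c) s s'.

Lemma exec_ext c s t : exec c s t -> forall s' t', s' =1 s -> t' =1 t ->
  exec c s' t'.
Proof.
elim=> {c s t} [i s t st|i s t st|c d s u t _ IHc _ IHd|i c s t s0 st
  |i c s u t s0 _ IHc _ IHw] s' t' ss' tt'.
- by apply: ExecInc => j; rewrite tt' st ss'.
- by apply: ExecDec => j; rewrite tt' st ss'.
- by apply: ExecSeq (IHc _ _ ss' (frefl u)) (IHd _ _ (frefl u) tt').
- by apply: ExecExit => [|j]; rewrite ?ss' // tt' st.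
- by apply: ExecLoop (IHc _ _ ss' (frefl u)) (IHw _ _ (frefl u) tt');
    rewrite ss'.
Qed.

(** Programs use the registers from 0 upwards; shifting them protects the
    values kept below, which organises the registers as a stack. *)
Fixpoint shift (c : cmd) : cmd :=
  match c with
  | Inc i => Inc i.+1
  | Dec i => Dec i.+1
  | c ;; d => shift c ;; shift d
  | While i c => While i.+1 (shift c)
  end.

Definition push (a : nat) (s : nat -> nat) (j : nat) : nat :=
  if j is j'.+1 then s j' else a.

Lemma exec_shift a c s t : exec c s t -> exec (shift c) (push a s) (push a t).
Proof.
elim=> {c s t} /= [i s t st|i s t st|c d s u t _ IHc _ IHd|i c s t s0 st
  |i c s u t s0 _ IHc _ IHw].
- by apply: ExecInc => -[|j] /=; rewrite ?addn0 ?st ?eqSS.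
- by apply: ExecDec => -[|j] /=; rewrite ?subn0 ?st ?eqSS.
- exact: ExecSeq IHc IHd.
- by apply: ExecExit => // -[|j] /=; rewrite ?st.
- exact: ExecLoop IHc IHw.
Qed.

(** All registers beyond the list contain 0, so that a program described by
    [runs] leaves its scratch registers clean. *)
Definition runs (c : cmd) (l l' : seq nat) : Prop :=
  exec c (nth 0 l) (nth 0 l').

Lemma runs_ext c l l' m m' : nth 0 m =1 nth 0 l -> nth 0 m' =1 nth 0 l' ->
  runs c l l' -> runs c m m'.
Proof. by rewrite /runs => ml ml' clm; apply: exec_ext clm _ _ ml ml'. Qed.

Lemma runs_seq c d l m n : runs c l m -> runs d m n -> runs (c ;; d) l n.
Proof. exact: ExecSeq. Qed.

Lemma runs_loop i c l m n : nth 0 l i != 0 -> runs c l m ->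
  runs (While i c) m n -> runs (While i c) l n.
Proof. exact: ExecLoop. Qed.

Lemma runs_exit i c l : nth 0 l i = 0 -> runs (While i c) l l.
Proof. by move=> ?; apply: ExecExit. Qed.

Lemma runs_shift c a l m : runs c l m -> runs (shift c) (a :: l) (a :: m).
Proof. by rewrite /runs => /(exec_shift a) clm; apply: exec_ext clm _ _ _ _; case. Qed.

(* Pointwise equality of finite register lists; the programs use at most eight
   registers. *)
Ltac registers :=
  let j := fresh in
  move=> j; do 8 (try destruct j as [|j]);
  rewrite /= ?nth_nil ?addn0 ?subn0 ?addn1 ?subn1 ?muln0 ?mul0n ?mul1n ?muln1
     ?add0n ?if_same //.

(** Destructive transfer of register i: moving, copying, doubling and clearing
    are the cases js = [:: j], [:: j; j'], [:: j; j] and [::]. *)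
Fixpoint pour_body (i : nat) (js : seq nat) : cmd :=
  if js is j :: js' then Inc j ;; pour_body i js' else Dec i.

Definition pour (i : nat) (js : seq nat) : cmd := While i (pour_body i js).

Lemma exec_pour_body i js s :
  exec (pour_body i js) s (fun j => s j + count_mem j js - (j == i)).
Proof.
elim: js s => [|j0 js IH] s /=.
  by apply: ExecDec => j /=; rewrite addn0.
apply: ExecSeq (ExecInc (fun=> erefl)) _.
apply: exec_ext (IH _) _ _ _ _ => // j /=.
by rewrite addnA [j == j0]eq_sym.
Qed.

Lemma exec_pour i js s t : i \notin js ->
  t =1 (fun j => if j == i then 0 else s j + s i * count_mem j js) ->
  exec (pour i js) s t.
Proof.
move=> ijs; elim: {s}(s i) {-2}s (erefl (s i)) t => [|n IH] s si t st.
  apply: ExecExit => // j; rewrite st; case: eqP => [->|]; by rewrite ?si ?addn0.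
apply: ExecLoop (exec_pour_body _ _ _) _; first by rewrite si.
have ci : count_mem i js = 0 by apply/count_memPn.
apply: IH => [|j]; first by rewrite ci si eqxx addn0 subn1.
rewrite st; case: eqP => // _; rewrite subn0 eqxx ci si addn0 subn1 mulSn.
by rewrite addnA.
Qed.

Lemma runs_pour i js l m : i \notin js ->
  nth 0 m =1 (fun j => if j == i then 0 else nth 0 l j + nth 0 l i * count_mem j js) ->
  runs (pour i js) l m.
Proof. exact: exec_pour. Qed.

Lemma runs_inc i l m : nth 0 m =1 (fun j => nth 0 l j + (j == i)) ->
  runs (Inc i) l m.
Proof. exact: ExecInc. Qed.

Lemma runs_dec i l m : nth 0 m =1 (fun j => nth 0 l j - (j == i)) ->
  runs (Dec i) l m.
Proof. exact: ExecDec. Qed.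

(* One command of a straight-line program, leading to the registers m. *)
Ltac run_step m := apply: (runs_seq (m := m));
  first by (apply: runs_pour || apply: runs_inc || apply: runs_dec) => //; registers; lia.
Ltac run_last :=
  by (apply: runs_pour || apply: runs_inc || apply: runs_dec) => //; registers; lia.

Definition cons_cmd : cmd :=
  pour 2 [:: 0; 0] ;; Inc 0 ;;
  While 1 (Dec 1 ;; pour 0 [:: 2; 2] ;; pour 2 [:: 0]).

Lemma runs_cons a m : runs cons_cmd [:: 0; a; m] [:: consn a m].
Proof.
run_step [:: m.*2; a; 0].
run_step [:: m.*2.+1; a; 0].
rewrite /consn; elim: a m.*2.+1 => [|a IH] x.
  by rewrite mul1n; apply: runs_ext (runs_exit _ _) => //; registers.
apply: (@runs_loop _ _ _ [:: 2 * x; a; 0]) => //; last by rewrite expnSr -mulnA.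
run_step [:: x; a; 0].
run_step [:: 0; a; 2 * x].
run_last.
Qed.

(** Registers: 0 dividend, 3 quotient, 4 remainder, 5 scratch.  The inner loop
    is a conditional: it runs at most once because it moves register 0 away. *)
Definition halve_cmd : cmd :=
  While 0 (Dec 0 ;; Inc 4 ;;
    While 0 (Dec 0 ;; Dec 4 ;; Inc 3 ;; pour 0 [:: 5]) ;;
    pour 5 [:: 0]).

Lemma runs_halve x a m q :
  runs halve_cmd [:: x; a; m; q] [:: 0; a; m; q + x./2; odd x : nat].
Proof.
have [n] := ubnP x; elim: n x q => // n IH [|[|x]] q; rewrite ?ltnS => ltxn.
- by apply: runs_ext (runs_exit _ _) => //; registers.
- apply: (@runs_loop _ _ _ [:: 0; a; m; q; 1]) => //.
    run_step [:: 0; a; m; q].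
    run_step [:: 0; a; m; q; 1].
    apply: (runs_seq (m := [:: 0; a; m; q; 1])); first exact: runs_exit.
    run_last.
  by apply: runs_ext (runs_exit _ _) => //; registers.
- apply: (@runs_loop _ _ _ [:: x; a; m; q.+1]) => //.
    run_step [:: x.+1; a; m; q].
    run_step [:: x.+1; a; m; q; 1].
    apply: (runs_seq (m := [:: 0; a; m; q.+1; 0; x])).
      apply: (@runs_loop _ _ _ [:: 0; a; m; q.+1; 0; x]) => //.
        run_step [:: x; a; m; q; 1].
        run_step [:: x; a; m; q; 0].
        run_step [:: x; a; m; q.+1; 0].
        run_last.
      exact: runs_exit.
    run_last.
  by rewrite /= negbK addnS -addSn; apply: IH; apply: ltnW.
Qed.

(** As the argument is 2 ^ a * (2 * m + 1), halving it until it is odd counts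
    the head a in register 1 and leaves the tail m as the last quotient.  Each
    round increments the counter; the round that meets the odd number takes this
    back. *)
Definition uncons_cmd : cmd :=
  While 0 (halve_cmd ;; Inc 1 ;;
    While 4 (Dec 4 ;; Dec 1 ;; pour 3 [:: 2]) ;; pour 3 [:: 0]).

Lemma runs_uncons x : runs uncons_cmd [:: x] [:: 0; hd x; tl x].
Proof.
have [->|x0] := posnP x; first by apply: runs_ext (runs_exit _ _) => //; registers.
suff main a m h : runs uncons_cmd [:: 2 ^ a * m.*2.+1; h] [:: 0; h + a; m].
  apply: runs_ext (main (hd x) (tl x) 0); last by rewrite add0n.
  by rewrite {1}(consn_hd_tl x0); registers.
elim: a h => [|a IH] h.
  rewrite mul1n addn0; apply: (@runs_loop _ _ _ [:: 0; h; m]) => //.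
    apply: (runs_seq (m := [:: 0; h; 0; m; 1])).
      apply: runs_ext (runs_halve _ _ _ _); first by registers.
      by rewrite /= uphalf_double odd_double; registers.
    run_step [:: 0; h.+1; 0; m; 1].
    apply: (runs_seq (m := [:: 0; h; m])).
      apply: (@runs_loop _ _ _ [:: 0; h; m]) => //; last exact: runs_exit.
      run_step [:: 0; h.+1; 0; m].
      run_step [:: 0; h; 0; m].
      run_last.
    run_last.
  exact: runs_exit.
have pos : 0 < 2 ^ a * m.*2.+1 by rewrite muln_gt0 expn_gt0.
apply: (@runs_loop _ _ _ [:: 2 ^ a * m.*2.+1; h.+1]); last by rewrite addnS -addSn.
  by rewrite /= -lt0n muln_gt0 expn_gt0.
rewrite expnS -mulnA mul2n; move: (2 ^ a * _) pos => y _.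
apply: (runs_seq (m := [:: 0; h; 0; y])).
  apply: runs_ext (runs_halve _ _ _ _); first by registers.
  by rewrite odd_double doubleK; registers.
run_step [:: 0; h.+1; 0; y].
apply: (runs_seq (m := [:: 0; h.+1; 0; y])); first exact: runs_exit.
run_last.
Qed.

(** * Primitive recursive functions *)

(** The unary primitive recursive functions, with coded pairs in place of
    several arguments. *)
Inductive PR : (nat -> nat) -> Prop :=
| PR_id : PR (fun x => x)
| PR_zero : PR (fun _ => 0)
| PR_succ f : PR f -> PR (fun x => (f x).+1)
| PR_hd f : PR f -> PR (fun x => hd (f x))
| PR_tl f : PR f -> PR (fun x => tl (f x))
| PR_cons f g : PR f -> PR g -> PR (fun x => consn (f x) (g x))
| PR_comp f g : PR f -> PR g -> PR (fun x => f (g x))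
| PR_iter0 f : PR f -> PR (fun x => iter (hd x) f (tl x))
| PR_ext f g : f =1 g -> PR f -> PR g.

(** By induction on the construction of f; a second argument is evaluated in
    shifted registers while the value of the first is kept below. *)
Lemma PR_cmd f : PR f -> exists c, forall x, runs c [:: x] [:: f x].
Proof.
elim=> {f} [||f _ [c Hc]|f _ [c Hc]|f _ [c Hc]|f g _ [c Hc] _ [d Hd]
  |f g _ [c Hc] _ [d Hd]|f _ [c Hc]|f g fg _ [c Hc]].
- by exists (While 1 (Inc 0)) => x; apply: runs_exit.
- by exists (pour 0 [::]) => x; run_last.
- by exists (c ;; Inc 0) => x; apply: runs_seq (Hc x) _; run_last.
- exists (c ;; uncons_cmd ;; pour 2 [::] ;; pour 1 [:: 0]) => x.
  apply: runs_seq (Hc x) _; apply: runs_seq (runs_uncons _) _.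
  run_step [:: 0; hd (f x)]; run_last.
- exists (c ;; uncons_cmd ;; pour 1 [::] ;; pour 2 [:: 0]) => x.
  apply: runs_seq (Hc x) _; apply: runs_seq (runs_uncons _) _.
  run_step [:: 0; 0; tl (f x)]; run_last.
- exists (pour 0 [:: 1; 2] ;; pour 2 [:: 0] ;; shift c ;; pour 0 [:: 2] ;;
          shift (shift d) ;; cons_cmd) => x.
  run_step [:: 0; x; x]; run_step [:: x; x].
  apply: runs_seq (runs_shift _ (Hc x)) _.
  run_step [:: 0; f x; x].
  apply: runs_seq (runs_shift _ (runs_shift _ (Hd x))) _.
  exact: runs_cons.
- by exists (d ;; c) => x; apply: runs_seq (Hd x) (Hc _).
- exists (uncons_cmd ;; pour 1 [:: 0] ;; pour 2 [:: 1] ;;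
          While 0 (Dec 0 ;; shift c) ;; pour 1 [:: 0]) => x.
  apply: runs_seq (runs_uncons x) _; move: (hd x) (tl x) => n y.
  run_step [:: n; 0; y]; run_step [:: n; y].
  apply: (runs_seq (m := [:: 0; iter n f y])); last by run_last.
  elim: n y => [|n IH] y; first exact: runs_exit.
  rewrite iterSr; apply: runs_loop (IH (f y)) => //.
  run_step [:: n; y]; exact: runs_shift.
- by exists c => x; rewrite -fg.
Qed.

(** * Closure properties *)

Lemma PR_const n : PR (fun _ => n).
Proof. elim: n => [|n IH]; [exact: PR_zero | exact: PR_succ IH]. Qed.

(** The closure properties have open form: the functions involved may depend on
    a context x.  Under a binder the context is paired with the bound values, and
    becomes a projection of the pair. *)
Lemma PR_iter s n z : PR n -> PR z -> PR (fun p => s (tl p) (hd p)) ->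
  PR (fun x => iter (n x) (s x) (z x)).
Proof.
move=> Hn Hz Hs.
pose g p := consn (s (tl p) (hd p)) (tl p).
have Hg : PR g by apply: PR_cons => //; apply: PR_tl PR_id.
have Hi : PR (fun x => hd (iter (hd (consn (n x) (consn (z x) x))) g
                             (tl (consn (n x) (consn (z x) x))))).
  apply: PR_hd; apply: (PR_comp (PR_iter0 Hg)).
  by apply: PR_cons => //; apply: PR_cons => //; apply: PR_id.
apply: PR_ext Hi => x; rewrite hd_consn tl_consn.
suff -> : iter (n x) g (consn (z x) x) = consn (iter (n x) (s x) (z x)) x.
  exact: hd_consn.
by elim: (n x) => //= m ->; rewrite /g hd_consn tl_consn.
Qed.

Fixpoint rec (z : nat) (s : nat -> nat -> nat) (n : nat) : nat :=
  if n is n'.+1 then s n' (rec z s n') else z.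

Lemma PR_rec s n z : PR n -> PR z ->
  PR (fun p => s (tl (tl p)) (hd p) (hd (tl p))) ->
  PR (fun x => rec (z x) (s x) (n x)).
Proof.
move=> Hn Hz Hs.
pose g x a := consn (hd a).+1 (s x (hd a) (tl a)).
apply: (@PR_ext (fun x => tl (iter (n x) (g x) (consn 0 (z x))))).
  move=> x; suff -> : iter (n x) (g x) (consn 0 (z x)) =
    consn (n x) (rec (z x) (s x) (n x)) by rewrite tl_consn.
  by elim: (n x) => //= m ->; rewrite /g hd_consn tl_consn.
apply: PR_tl; apply: PR_iter => //; first by apply: PR_cons => //; apply: PR_zero.
have H1 : PR (fun p => hd (hd p)) by do 2 apply: PR_hd; apply: PR_id.
have H2 : PR (fun p => consn (hd (hd p)) (consn (tl (hd p)) (tl p))).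
  apply: PR_cons => //; apply: PR_cons; last exact: PR_tl PR_id.
  by apply: PR_tl; apply: PR_hd; apply: PR_id.
apply: PR_cons; first exact: PR_succ.
by apply: PR_ext (PR_comp Hs H2) => p /=; rewrite ?(hd_consn, tl_consn).
Qed.

Lemma PR_if (b : nat -> bool) u v : PR (fun x => b x) -> PR u -> PR v ->
  PR (fun x => if b x then u x else v x).
Proof.
move=> Hb Hu Hv; apply: (@PR_ext (fun x => rec (v x) (fun _ _ => u x) (b x))).
  by move=> x; case: (b x).
apply: PR_rec => //; apply: (PR_comp Hu); apply: PR_tl; exact: PR_tl PR_id.
Qed.

Lemma PR_pred n : PR n -> PR (fun x => (n x).-1).
Proof.
move=> Hn; apply: (@PR_ext (fun x => rec 0 (fun i _ => i) (n x))).
  by move=> x; case: (n x).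
by apply: PR_rec => //; [exact: PR_zero | exact: PR_hd PR_id].
Qed.

Lemma PR_add m n : PR m -> PR n -> PR (fun x => m x + n x).
Proof.
move=> Hm Hn; apply: (@PR_ext (fun x => iter (n x) succn (m x))).
  by move=> x; rewrite iter_succn.
by apply: (@PR_iter (fun=> succn)) => //; apply: PR_succ; apply: PR_hd PR_id.
Qed.

Lemma PR_sub m n : PR m -> PR n -> PR (fun x => m x - n x).
Proof.
move=> Hm Hn; apply: (@PR_ext (fun x => iter (n x) predn (m x))).
  by move=> x; rewrite iter_predn.
by apply: (@PR_iter (fun=> predn)) => //; apply: PR_pred; apply: PR_hd PR_id.
Qed.

Lemma PR_leq m n : PR m -> PR n -> PR (fun x => m x <= n x).
Proof.
move=> Hm Hn; apply: (@PR_ext (fun x => rec 1 (fun _ _ => 0) (m x - n x))).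
  by move=> x; rewrite /leq; case: (_ - _).
by apply: PR_rec; [exact: PR_sub | exact: PR_const | exact: PR_zero].
Qed.

Lemma PR_and (a b : nat -> bool) : PR (fun x => a x) -> PR (fun x => b x) ->
  PR (fun x => a x && b x).
Proof.
move=> Ha Hb; apply: PR_ext (PR_if Ha Hb PR_zero) => x; by case: (a x).
Qed.

Lemma PR_or (a b : nat -> bool) : PR (fun x => a x) -> PR (fun x => b x) ->
  PR (fun x => a x || b x).
Proof.
move=> Ha Hb; apply: PR_ext (PR_if Ha (PR_const 1) Hb) => x; by case: (a x).
Qed.

Lemma PR_not (a : nat -> bool) : PR (fun x => a x) -> PR (fun x => ~~ a x).
Proof.
move=> Ha; apply: PR_ext (PR_if Ha PR_zero (PR_const 1)) => x; by case: (a x).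
Qed.

Lemma PR_eq m n : PR m -> PR n -> PR (fun x => m x == n x).
Proof.
move=> Hm Hn; apply: (@PR_ext (fun x => (m x <= n x) && (n x <= m x))).
  by move=> x; rewrite eqn_leq.
by apply: PR_and; apply: PR_leq.
Qed.

Lemma size_le_code l : size l <= code l.
Proof.
elim: l => //= a l IH; apply: leq_ltn_trans IH _.
apply: (@leq_trans (code l).*2.+1); first by rewrite ltnS -addnn leq_addr.
by rewrite leq_pmull // expn_gt0.
Qed.

(** The code of a list bounds its length, and an exhausted list is left
    unchanged, so iterating as often as the code says reaches the end. *)
Lemma PR_foldl s z l : PR (fun x => code (l x)) -> PR z ->
  PR (fun p => s (tl (tl p)) (hd p) (hd (tl p))) ->
  PR (fun x => foldl (s x) (z x) (l x)).
Proof.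
move=> Hl Hz Hs.
pose g (x a : nat) := if hd a == 0 then a else consn (tl (hd a)) (s x (tl a) (hd (hd a))).
apply: (@PR_ext (fun x => tl (iter (code (l x)) (g x) (consn (code (l x)) (z x))))).
  move=> x; suff main N t y : size t <= N ->
      iter N (g x) (consn (code t) y) = consn 0 (foldl (s x) y t).
    by rewrite main ?tl_consn ?size_le_code.
  elim: N t y => [|N IH] [|a t] y // tN; rewrite iterSr /g hd_consn.
    exact: (IH [::]).
  rewrite code_cons eqn0Ngt consn_gt0 /= hd_consn !tl_consn; exact: IH.
apply: PR_tl; apply: PR_iter => //; first exact: PR_cons.
have H1 : PR (fun p => hd (hd p)) by do 2 apply: PR_hd; apply: PR_id.
apply: PR_if; [by apply: PR_eq => //; apply: PR_zero | exact: PR_hd PR_id |].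
apply: PR_cons; first exact: PR_tl.
have H2 : PR (fun p => consn (tl (hd p)) (consn (hd (hd (hd p))) (tl p))).
  apply: PR_cons; first by apply: PR_tl; apply: PR_hd PR_id.
  by cbv beta; apply: PR_cons; [exact: PR_hd | exact: PR_tl PR_id].
by apply: PR_ext (PR_comp Hs H2) => p /=; rewrite ?(hd_consn, tl_consn).
Qed.

Lemma PR_rev l : PR (fun x => code (l x)) -> PR (fun x => code (rev (l x))).
Proof.
move=> Hl; apply: (@PR_ext (fun x => foldl (fun acc a => consn a acc) 0 (l x))).
  move=> x; rewrite -[l x]revK; move: (rev (l x)) => t; rewrite revK foldl_rev.
  by elim: t => //= a t ->.
apply: (@PR_foldl (fun _ acc a => consn a acc)) => //; first exact: PR_zero.
by cbv beta; apply: PR_cons; [apply: PR_hd; apply: PR_tl PR_id | exact: PR_hd PR_id].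
Qed.

Lemma PR_foldr s z l : PR (fun x => code (l x)) -> PR z ->
  PR (fun p => s (tl (tl p)) (hd p) (hd (tl p))) ->
  PR (fun x => foldr (s x) (z x) (l x)).
Proof.
move=> Hl Hz Hs.
apply: (@PR_ext (fun x => foldl (fun acc a => s x a acc) (z x) (rev (l x)))).
  by move=> x; rewrite foldl_rev.
apply: (@PR_foldl (fun x acc a => s x a acc)) => //; first exact: PR_rev.
have H : PR (fun p => consn (hd (tl p)) (consn (hd p) (tl (tl p)))).
  apply: PR_cons; first by apply: PR_hd; apply: PR_tl PR_id.
  by cbv beta; apply: PR_cons; [exact: PR_hd PR_id | apply: PR_tl; apply: PR_tl PR_id].
by apply: PR_ext (PR_comp Hs H) => p /=; rewrite ?(hd_consn, tl_consn).
Qed.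

Lemma PR_map s l : PR (fun x => code (l x)) -> PR (fun p => s (tl p) (hd p)) ->
  PR (fun x => code (map (s x) (l x))).
Proof.
move=> Hl Hs; apply: (@PR_ext (fun x => foldr (fun a acc => consn (s x a) acc) 0 (l x))).
  by move=> x; elim: (l x) => //= a t ->.
apply: (@PR_foldr (fun x a acc => consn (s x a) acc)) => //; first exact: PR_zero.
have H : PR (fun p => consn (hd p) (tl (tl p))).
  by cbv beta; apply: PR_cons; [exact: PR_hd PR_id | apply: PR_tl; apply: PR_tl PR_id].
apply: PR_cons; last by apply: PR_hd; apply: PR_tl PR_id.
by apply: PR_ext (PR_comp Hs H) => p /=; rewrite ?(hd_consn, tl_consn).
Qed.

Lemma PR_cat l m : PR (fun x => code (l x)) -> PR (fun x => code (m x)) ->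
  PR (fun x => code (l x ++ m x)).
Proof.
move=> Hl Hm; apply: (@PR_ext (fun x => foldr consn (code (m x)) (l x))).
  by move=> x; elim: (l x) => //= a t ->.
apply: (@PR_foldr (fun=> consn)) => //.
by cbv beta; apply: PR_cons; [exact: PR_hd PR_id | apply: PR_hd; apply: PR_tl PR_id].
Qed.

Lemma nth_iter_tl l i : nth 0 l i = hd (iter i tl (code l)).
Proof.
elim: i l => [|i IH] [|a l] //; rewrite ?iterSr.
- by rewrite code_cons hd_consn.
- by rewrite /= -(IH [::]) nth_nil.
- by rewrite code_cons tl_consn -IH.
Qed.

Lemma PR_nth l i : PR (fun x => code (l x)) -> PR i ->
  PR (fun x => nth 0 (l x) (i x)).
Proof.
move=> Hl Hi; apply: (@PR_ext (fun x => hd (iter (i x) tl (code (l x))))).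
  by move=> x; rewrite nth_iter_tl.
by apply: PR_hd; apply: (@PR_iter (fun=> tl)) => //; apply: PR_tl; apply: PR_hd PR_id.
Qed.

Lemma PR_count (a : nat -> pred nat) l : PR (fun x => code (l x)) ->
  PR (fun p => a (tl p) (hd p)) -> PR (fun x => count (a x) (l x)).
Proof.
move=> Hl Ha.
apply: (@PR_ext (fun x => foldr (fun b n => b + n) 0 (map (fun y => a x y : nat) (l x)))).
  by move=> x; elim: (l x) => //= b t ->.
apply: (@PR_foldr (fun=> addn)).
- exact: (@PR_map (fun x y => a x y)).
- exact: PR_zero.
- by cbv beta; apply: PR_add; [exact: PR_hd PR_id | apply: PR_hd; apply: PR_tl PR_id].
Qed.

Lemma PR_all (a : nat -> pred nat) l : PR (fun x => code (l x)) ->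
  PR (fun p => a (tl p) (hd p)) -> PR (fun x => all (a x) (l x)).
Proof.
move=> Hl Ha.
apply: (@PR_ext (fun x => count (predC (a x)) (l x) == 0)).
  by move=> x; rewrite all_count -(count_predC (a x)) -[X in X == _ + _]addn0 eqn_add2l eq_sym.
by apply: PR_eq PR_zero; apply: PR_count => //; apply: PR_not.
Qed.

Lemma PR_size l : PR (fun x => code (l x)) -> PR (fun x => size (l x)).
Proof.
move=> Hl; apply: (@PR_ext (fun x => count predT (l x))).
  by move=> x; rewrite count_predT.
by apply: (@PR_count (fun=> predT)) => //; apply: PR_const.
Qed.

Lemma PR_mem v l : PR v -> PR (fun x => code (l x)) -> PR (fun x => v x \in l x).
Proof.
move=> Hv Hl; apply: (@PR_ext (fun x => ~~ (count_mem (v x) (l x) == 0))).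
  by move=> x; rewrite -lt0n -has_count has_pred1.
apply: PR_not; apply: PR_eq PR_zero; apply: (@PR_count (fun x => pred1 (v x))) => //=.
by apply: PR_eq; [exact: PR_hd PR_id | exact: (PR_comp Hv (PR_tl PR_id))].
Qed.

Lemma PR_index v l : PR v -> PR (fun x => code (l x)) ->
  PR (fun x => index (v x) (l x)).
Proof.
move=> Hv Hl.
apply: (@PR_ext (fun x => foldr (fun a n => if a == v x then 0 else n.+1) 0 (l x))).
  by move=> x; elim: (l x) => //= a t ->.
apply: (@PR_foldr (fun x a n => if a == v x then 0 else n.+1)) => //; first exact: PR_zero.
apply: (@PR_if (fun p => hd p == v (tl (tl p)))); last 2 first.
- exact: PR_zero.
- by apply: PR_succ; apply: PR_hd; apply: PR_tl PR_id.
apply: PR_eq; first exact: PR_hd PR_id.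
by apply: (PR_comp Hv); apply: PR_tl; apply: PR_tl PR_id.
Qed.

Lemma PR_iota n : PR n -> PR (fun x => code (iota 0 (n x))).
Proof.
move=> Hn.
apply: (@PR_ext (fun x => code (rev (decode (rec 0 consn (n x)))))).
  move=> x; congr code; elim: (n x) => [|m IH] //.
  by rewrite [rec _ _ _]/= decode_consn rev_cons IH -cats1 -[m.+1]addn1 iotaD.
apply: PR_rev; apply: (@PR_ext (fun x => rec 0 consn (n x))).
  by move=> x; rewrite CodeSeq.decodeK.
apply: (@PR_rec (fun=> consn)) => //; first exact: PR_zero.
by cbv beta; apply: PR_cons; [exact: PR_hd PR_id | apply: PR_hd; apply: PR_tl PR_id].
Qed.

Lemma PR_decode f : PR f -> PR (fun x => code (decode (f x))).
Proof. by apply: PR_ext => x; rewrite CodeSeq.decodeK. Qed.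

Lemma PR_code_cons a l : PR a -> PR (fun x => code (l x)) ->
  PR (fun x => code (a x :: l x)).
Proof. exact: PR_cons. Qed.

(** A bounded quantification in place of the recursion on suffixes. *)
Lemma uniq_index (l : seq nat) :
  uniq l = all (fun i => index (nth 0 l i) l == i) (iota 0 (size l)).
Proof.
apply/idP/allP => [ul i|H].
  by rewrite mem_iota /= => il; rewrite index_uniq.
apply/(uniqP 0) => i j il jl eq_ij.
have inj m : m < size l -> index (nth 0 l m) l = m.
  by move=> ml; apply/eqP/H; rewrite mem_iota.
by rewrite -(inj i) // eq_ij inj.
Qed.

(** Proves membership in [PR] following the head symbol of the body.  Conditionals are
    left to unification, which may produce [hd] and [tl] without their
    argument. *)
Ltac pr1 :=
  match goal with
  | |- PR (fun x => x) => exact: PR_id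
  | |- PR hd => exact: (PR_hd PR_id)
  | |- PR tl => exact: (PR_tl PR_id)
  | |- PR (fun x => ?c) => exact: PR_const
  | H : PR ?f |- PR (fun x => ?f (@?a x)) => refine (@PR_comp f a H _)
  | H : PR (fun x => nat_of_bool (?f x)) |- PR (fun x => nat_of_bool (?f (@?a x))) =>
      refine (@PR_comp (fun x => nat_of_bool (f x)) a H _)
  | H : PR (fun x => code (?f x)) |- PR (fun x => code (?f (@?a x))) =>
      refine (@PR_comp (fun x => code (f x)) a H _)
  | |- PR (fun x => S (@?a x)) => apply: (@PR_succ a)
  | |- PR (fun x => predn (@?a x)) => apply: (@PR_pred a)
  | |- PR (fun x => hd (@?a x)) => apply: (@PR_hd a)
  | |- PR (fun x => tl (@?a x)) => apply: (@PR_tl a)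
  | |- PR (fun x => consn (@?a x) (@?b x)) => apply: (@PR_cons a b)
  | |- PR (fun x => addn (@?a x) (@?b x)) => apply: (@PR_add a b)
  | |- PR (fun x => subn (@?a x) (@?b x)) => apply: (@PR_sub a b)
  | |- PR (fun x => if _ then _ else _) => refine (@PR_if _ _ _ _ _ _)
  | |- PR (fun x => rec (@?z x) (@?s x) (@?n x)) => apply: (@PR_rec s n z)
  | |- PR (fun x => iter (@?n x) (@?s x) (@?z x)) => apply: (@PR_iter s n z)
  | |- PR (fun x => foldr (@?s x) (@?z x) (@?l x)) => apply: (@PR_foldr s z l)
  | |- PR (fun x => nth 0 (@?l x) (@?i x)) => apply: (@PR_nth l i)
  | |- PR (fun x => index (@?v x) (@?l x)) => apply: (@PR_index v l)
  | |- PR (fun x => size (@?l x)) => apply: (@PR_size l)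
  | |- PR (fun x => count (@?a x) (@?l x)) => apply: (@PR_count a l)
  | |- PR (fun x => nat_of_bool (all (@?a x) (@?l x))) => apply: (@PR_all a l)
  | |- PR (fun x => nat_of_bool (andb (@?a x) (@?b x))) => apply: (@PR_and a b)
  | |- PR (fun x => nat_of_bool (orb (@?a x) (@?b x))) => apply: (@PR_or a b)
  | |- PR (fun x => nat_of_bool (negb (@?a x))) => apply: (@PR_not a)
  | |- PR (fun x => nat_of_bool (@eq_op _ (@?a x) (@?b x))) => apply: (@PR_eq a b)
  | |- PR (fun x => nat_of_bool
           (@PredOfSimpl.coerce _ (@pred1 _ (@?v x)) (@?a x))) =>
      refine (@PR_eq a v _ _)
  | |- PR (fun x => nat_of_bool (leq (@?a x) (@?b x))) => apply: (@PR_leq a b)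
  | |- PR (fun x => nat_of_bool (@?v x \in @?l x)) => apply: (@PR_mem v l)
  | |- PR (fun x => code (decode (@?a x))) => apply: (@PR_decode a)
  | |- PR (fun x => code (map (@?s x) (@?l x))) => apply: (@PR_map s l)
  | |- PR (fun x => code (cat (@?l x) (@?m x))) => apply: (@PR_cat l m)
  | |- PR (fun x => code (rev (@?l x))) => apply: (@PR_rev l)
  | |- PR (fun x => code (iota 0 (@?n x))) => apply: (@PR_iota n)
  | |- PR (fun x => code (cons (@?a x) (@?l x))) =>
       apply: (@PR_code_cons a l)
  end; cbv beta.

Ltac pr := repeat pr1.

Lemma PR_uniq l : PR (fun x => code (l x)) -> PR (fun x => uniq (l x)).
Proof.
move=> Hl; apply: (@PR_ext (fun x => all (fun i => index (nth 0 (l x) i) (l x) == i)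
   (iota 0 (size (l x))))).
  by move=> x; rewrite uniq_index.
by pr.
Qed.

(** * Register programs on Turing machines *)

(** A tape symbol carries one bit for each of k registers (bit 0 is the parity),
    so a blank has no bit set, and the symbol 1 has exactly bit 0. *)
Fixpoint enc (k : nat) (b : nat -> bool) : nat :=
  if k is k'.+1 then b 0 + (enc k' (fun i => b i.+1)).*2 else 0.

Fixpoint bit (i x : nat) : bool := if i is i'.+1 then bit i' x./2 else odd x.

Fixpoint flip (i x : nat) : nat :=
  if i is i'.+1 then odd x + (flip i' x./2).*2 else ~~ odd x + x./2.*2.

Lemma eq_enc k b b' : b =1 b' -> enc k b = enc k b'.
Proof.
elim: k b b' => //= k IH b b' bb'; rewrite bb'; congr (_ + _.*2).
by apply: IH => i.
Qed.

Lemma enc_lt k b : enc k b < 2 ^ k.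
Proof.
elim: k b => //= k IH b; rewrite expnS mul2n.
by move: (IH (fun i => b i.+1)); case: (b 0); lia.
Qed.

Lemma odd_enc k b : odd (enc k.+1 b) = b 0.
Proof. by rewrite /= oddD odd_double addbF oddb. Qed.

Lemma half_enc k b : (enc k.+1 b)./2 = enc k (fun i => b i.+1).
Proof. by rewrite /= half_bit_double. Qed.

Lemma bit_enc k i b : i < k -> bit i (enc k b) = b i.
Proof.
elim: k i b => // k IH [|i] b ik; rewrite [LHS]/bit -/bit ?odd_enc //.
by rewrite half_enc IH.
Qed.

Lemma flip_enc k i b : i < k ->
  flip i (enc k b) = enc k (fun j => if j == i then ~~ b j else b j).
Proof.
elim: k i b => // k IH [|i] b ik; rewrite [LHS]/flip -/flip odd_enc half_enc.
  by [].
by rewrite IH.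
Qed.

Lemma enc_false k b : (forall i, b i = false) -> enc k b = 0.
Proof. by elim: k b => //= k IH b b0; rewrite b0 IH. Qed.

(** What to do in one state, as a function of the scanned symbol: next state,
    symbol written, and whether to move right. *)
Definition row := nat -> nat * nat * bool.

Fixpoint csize (c : cmd) : nat :=
  match c with
  | Inc _ => 2
  | Dec _ => 3
  | c ;; d => csize c + csize d
  | While _ c => csize c + 5
  end.

Definition move_if (b : bool) (p q x : nat) : nat * nat * bool :=
  if b then (p, x, true) else (q, x, false).

Section Tables.

Variable k : nat.
Let M := 2 ^ k.

(** Returning to the cell behind the marker 2 ^ k, the rest position of the
    head: run left to the marker and step right.  Every step moves the head, so
    a command can end only by stepping away from the marker. *)
Definition home_row (p q : nat) : row := fun x => move_if (x == 2 ^ k) q p x.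

(** State q + j obeys the j-th row, and the exit state is q + csize c.  As
    register i is the number of cells with bit i set, incrementing flips the first
    clear bit of the track and decrementing flips the last set one; if there is
    none the head is on the marker. *)
Fixpoint rows (q : nat) (c : cmd) : seq row :=
  match c with
  | Inc i => [:: fun x => if bit i x then (q, x, true) else (q.+1, flip i x, false);
                 home_row q.+1 q.+2]
  | Dec i => [:: fun x => if bit i x then (q, x, true) else (q.+1, x, false);
                 fun x => if x == 2 ^ k then (q.+3, x, true)
                          else (q.+2, flip i x, false);
                 home_row q.+2 q.+3]
  | c ;; d => rows q c ++ rows (q + csize c) d
  | While i c =>
      let e := q.+2 + csize c in
      [:: fun x => ((if bit i x then q.+1 else e.+2), x, false);
          home_row q.+1 q.+2] ++
      rows q.+2 c ++
      [:: fun x => (e.+1, x, false); home_row e.+1 q; home_row e.+2 e.+3]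
  end.

Lemma size_rows q c : size (rows q c) = csize c.
Proof.
elim: c q => //= [c IHc d IHd|i c IHc] q; rewrite size_cat ?IHc ?IHd //=.
by rewrite addnC; lia.
Qed.

Variable P : machine.

(** Correctness of a command depends only on how the machine behaves in the
    states of its table. *)
Definition row_at (q : nat) (r : row) : Prop :=
  forall l t, head 0 t <= M ->
    step P (Config q l t) = Some
      (let: (q', w, m) := r (head 0 t) in
       if m then Config q' (w :: l) (behead t)
       else Config q' (behead l) (head 0 l :: w :: behead t)).

Fixpoint rows_at (q : nat) (rs : seq row) : Prop :=
  if rs is r :: rs' then row_at q r /\ rows_at q.+1 rs' else True.

Lemma rows_at_cat q rs rs' :
  rows_at q (rs ++ rs') <-> rows_at q rs /\ rows_at (q + size rs) rs'.
Proof.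
elim: rs q => [|r rs IH] q /=; first by rewrite addn0; split=> // -[].
by rewrite IH addSnnS; split=> [[? []]|[[]]].
Qed.

Lemma rows_at_nth r0 q rs :
  (forall j, j < size rs -> row_at (q + j) (nth r0 rs j)) -> rows_at q rs.
Proof.
elim: rs q => //= r rs IH q rsP; split; first by have := rsP 0 isT; rewrite addn0.
by apply: IH => j jrs; rewrite addSnnS; apply: (rsP j.+1).
Qed.

Definition runTM (n : nat) (cf : config) : option config :=
  iter n (obind (step P)) (Some cf).

Definition reach (cf cf' : config) : Prop := exists n, runTM n cf = Some cf'.

Lemma runTMS n cf : runTM n.+1 cf = if step P cf is Some cf' then runTM n cf' else None.
Proof.
rewrite /runTM iterSr /=; case: (step P cf) => //.
by elim: n => //= n ->.
Qed.

Lemma reach_refl cf : reach cf cf. Proof. by exists 0. Qed.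

Lemma runTMD m n cf cf' : runTM m cf = Some cf' -> runTM (m + n) cf = runTM n cf'.
Proof. by rewrite /runTM addnC iterD => ->. Qed.

Lemma runTM_le m n cf cf1 cf2 : runTM m cf = Some cf1 ->
  runTM n cf = Some cf2 -> step P cf2 = None ->
  m <= n /\ runTM (n - m) cf1 = Some cf2.
Proof.
move=> Hm Hn stop; have mn : m <= n.
  rewrite leqNgt; apply/negP => nm; move: Hm.
  by rewrite -(subnK nm) addnC addSnnS (runTMD _ Hn) runTMS stop.
by split=> //; rewrite -(runTMD _ Hm) subnKC.
Qed.

Lemma reach_trans cf cf1 cf2 : reach cf cf1 -> reach cf1 cf2 -> reach cf cf2.
Proof. by move=> [m Hm] [n Hn]; exists (m + n); rewrite (runTMD _ Hm). Qed.

Lemma reach_step cf cf' : step P cf = Some cf' -> reach cf cf'.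
Proof. by move=> H; exists 1; rewrite runTMS H. Qed.

(** The cells left of the head are recorded exactly, those to the right up to
    trailing blanks. *)
Definition at_ (q : nat) (T : nat -> nat) (h : nat) (cf : config) : Prop :=
  [/\ state cf = q, lpart cf = rev (mkseq T h)
    & forall j, nth 0 (rpart cf) j = T (h + j)].

Lemma at_ext q T T' h cf : T =1 T' -> at_ q T h cf -> at_ q T' h cf.
Proof.
move=> TT' [? l r]; split=> // [|j]; last by rewrite -TT'.
by rewrite l (eq_mkseq TT').
Qed.

Lemma at_right q r T h cf q' w : row_at q r -> at_ q T h cf -> T h <= M ->
  r (T h) = (q', w, true) ->
  exists2 cf', step P cf = Some cf'
    & at_ q' (fun j => if j == h then w else T j) h.+1 cf'.
Proof.
case: cf => p l t qr [pq lT tT] ThM rT; rewrite /= in pq lT tT; subst p l.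
have ht : head 0 t = T h by rewrite -nth0 tT addn0.
rewrite qr ht // rT; eexists; first by [].
split=> //= [|j].
  rewrite mkseqS rev_rcons eqxx; congr (_ :: rev _).
  by apply/eq_in_map => j; rewrite mem_iota /= add0n => /ltn_eqF ->.
by rewrite nth_behead tT -addSnnS gtn_eqF // ltn_addr.
Qed.

Lemma at_left q r T h cf q' w : row_at q r -> at_ q T h.+1 cf -> T h.+1 <= M ->
  r (T h.+1) = (q', w, false) ->
  exists2 cf', step P cf = Some cf'
    & at_ q' (fun j => if j == h.+1 then w else T j) h cf'.
Proof.
case: cf => p l t qr [pq lT tT] ThM rT; rewrite /= in pq lT tT; subst p l.
have ht : head 0 t = T h.+1 by rewrite -nth0 tT addn0.
rewrite qr ht // rT; eexists; first by [].
split=> //= [|[|[|j]]] /=.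
- rewrite mkseqS rev_rcons /=; congr rev.
  by apply/eq_in_map => j; rewrite mem_iota /= add0n => /leqW/ltn_eqF ->.
- by rewrite mkseqS rev_rcons addn0 ltn_eqF.
- by rewrite addn1 eqxx.
- by rewrite nth_behead tT gtn_eqF; [congr T; lia | lia].
Qed.

Lemma sweep_right q r T cf h d : row_at q r -> at_ q T h cf ->
  (forall j, T j <= M) ->
  (forall j, h <= j < h + d -> r (T j) = (q, T j, true)) ->
  exists2 cf', reach cf cf' & at_ q T (h + d) cf'.
Proof.
move=> qr + TM; elim: d h cf => [|d IH] h cf hcf rT.
  by exists cf; [exact: reach_refl | rewrite addn0].
have [|cf1 s1 a1] := at_right qr hcf (TM h) (q' := q) (w := T h).
  by apply: rT; lia.
have {}a1 : at_ q T h.+1 cf1.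
  by apply: at_ext a1 => j; case: eqP => // ->.
have [j jh|cf2 r2 a2] := IH _ _ a1; first by apply: rT; lia.
by exists cf2; [exact: reach_trans (reach_step s1) r2 | rewrite -addSnnS].
Qed.

Lemma sweep_left q r T cf h : row_at q r -> at_ q T h cf ->
  (forall j, T j <= M) ->
  (forall j, 0 < j <= h -> r (T j) = (q, T j, false)) ->
  exists2 cf', reach cf cf' & at_ q T 0 cf'.
Proof.
move=> qr + TM; elim: h cf => [|h IH] cf hcf rT.
  by exists cf; first exact: reach_refl.
have [|cf1 s1 a1] := at_left qr hcf (TM _) (q' := q) (w := T h.+1).
  by apply: rT; lia.
have {}a1 : at_ q T h cf1.
  by apply: at_ext a1 => j; case: eqP => // ->.
have [j jh|cf2 r2 a2] := IH _ a1; first by apply: rT; lia.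
by exists cf2; first exact: reach_trans (reach_step s1) r2.
Qed.

(** Track i is a block of length s i, and position 0 holds a marker that is
    no vector of bits. *)
Definition cell (s : nat -> nat) (j : nat) : nat := enc k (fun i => j < s i).
Definition tape (s : nat -> nat) (j : nat) : nat :=
  if j is j'.+1 then cell s j' else M.

Lemma tape_le s j : tape s j <= M.
Proof. by case: j => //= j; rewrite ltnW ?enc_lt. Qed.

Lemma tape_neq s j : 0 < j -> (tape s j == M) = false.
Proof. by case: j => //= j _; rewrite ltn_eqF ?enc_lt. Qed.

Lemma eq_tape s s' : s =1 s' -> tape s =1 tape s'.
Proof. by move=> ss' [|j] //=; apply: eq_enc => i; rewrite ss'. Qed.

Lemma bit_tape s i j : i < k -> bit i (tape s j.+1) = (j < s i).
Proof. by move=> ik; rewrite bit_enc. Qed.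

Lemma go_home p q s h cf : row_at p (home_row p q) -> at_ p (tape s) h cf ->
  exists2 cf', reach cf cf' & at_ q (tape s) 1 cf'.
Proof.
move=> pr hcf.
have [j j0|cf1 r1 a1] := sweep_left pr hcf (tape_le s).
  by rewrite /home_row /move_if -/M tape_neq //; case/andP: j0.
have [|cf2 s2 a2] := at_right pr a1 (tape_le s _) (q' := q) (w := M).
  by rewrite /home_row /move_if eqxx.
exists cf2; first exact: reach_trans r1 (reach_step s2).
by apply: at_ext a2 => -[].
Qed.

Fixpoint width (c : cmd) : nat :=
  match c with
  | Inc i | Dec i => i.+1
  | c ;; d => maxn (width c) (width d)
  | While i c => maxn i.+1 (width c)
  end.

(** The first clear bit of track i is at position s i + 1. *)
Lemma find_end q r i s cf : row_at q r -> i < k -> at_ q (tape s) 1 cf ->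
  (forall x, bit i x -> r x = (q, x, true)) ->
  exists2 cf', reach cf cf' & at_ q (tape s) (s i).+1 cf'.
Proof.
move=> qr ik hcf rT; have [j /andP[]|] := sweep_right qr hcf (tape_le s) (d := s i).
  by case: j => // j _; rewrite add1n ltnS => js; rewrite rT // bit_tape.
by rewrite add1n => cf' r' a'; exists cf'.
Qed.

Lemma inc_correct q i s s' cf : i < k -> rows_at q (rows q (Inc i)) ->
  s' =1 (fun j => s j + (j == i)) -> at_ q (tape s) 1 cf ->
  exists2 cf', reach cf cf' & at_ q.+2 (tape s') 1 cf'.
Proof.
move=> ik /= [qr [qr1 _]] ss' hcf.
have [|cf1 r1 a1] := find_end qr ik hcf; first by move=> x ->.
have [|cf2 s2 a2] := at_left qr a1 (tape_le _ _) (q' := q.+1)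
  (w := flip i (tape s (s i).+1)).
  by rewrite bit_tape // ltnn.
have {}a2 : at_ q.+1 (tape s') (s i) cf2.
  apply: at_ext a2 => -[|j] //=; rewrite eqSS /cell.
  case: eqP => [->|/eqP ji]; rewrite ?flip_enc //; apply: eq_enc => i'; rewrite ss'.
    by case: eqP => [->|]; rewrite ?ltnn ?addn1 ?ltnSn ?addn0.
  by case: eqP => [->|]; rewrite ?addn0 // addn1 ltnS [j <= _]leq_eqVlt (negbTE ji).
have [cf3 r3 a3] := go_home qr1 a2.
by exists cf3 => //; apply: reach_trans r1 (reach_trans (reach_step s2) r3).
Qed.

Lemma dec_correct q i s s' cf : i < k -> rows_at q (rows q (Dec i)) ->
  s' =1 (fun j => s j - (j == i)) -> at_ q (tape s) 1 cf ->
  exists2 cf', reach cf cf' & at_ q.+3 (tape s') 1 cf'.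
Proof.
move=> ik /= [qr [qr1 [qr2 _]]] ss' hcf.
have [|cf1 r1 a1] := find_end qr ik hcf; first by move=> x ->.
have [|cf2 s2 a2] := at_left qr a1 (tape_le _ _) (q' := q.+1)
  (w := tape s (s i).+1).
  by rewrite bit_tape // ltnn.
have {}a2 : at_ q.+1 (tape s) (s i) cf2.
  by apply: at_ext a2 => j; case: eqP => // ->.
have r2 := reach_trans r1 (reach_step s2).
case si: (s i) => [|n] in a2.
  have [|cf3 s3 a3] := at_right qr1 a2 (tape_le _ _) (q' := q.+3) (w := M).
    by rewrite eqxx.
  exists cf3; first exact: reach_trans r2 (reach_step s3).
  apply: at_ext a3 => -[|j] //=; apply: eq_enc => j'.
  by rewrite ss'; case: eqP => [->|]; rewrite ?si ?subn0.
have [|cf3 s3 a3] := at_left qr1 a2 (tape_le _ _) (q' := q.+2)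
  (w := flip i (tape s n.+1)).
  by rewrite -/M tape_neq.
have {}a3 : at_ q.+2 (tape s') n cf3.
  apply: at_ext a3 => -[|j] //=; rewrite eqSS /cell.
  case: eqP => [->|/eqP ji]; rewrite ?flip_enc //; apply: eq_enc => i'; rewrite ss'.
    by case: eqP => [->|]; rewrite ?si ?ltnSn ?subn1 ?ltnn ?subn0.
  case: eqP => [->|]; rewrite ?subn0 // si subn1 /= ltnS leq_eqVlt.
  by rewrite (negbTE ji).
have [cf4 r4 a4] := go_home qr2 a3.
by exists cf4 => //; apply: reach_trans r2 (reach_trans (reach_step s3) r4).
Qed.

(** The first step is exhibited: it makes the running time drop in the
    proof that an endless loop does not halt. *)
Lemma test_true q i c s cf : i < k -> rows_at q (rows q (While i c)) ->
  s i != 0 -> at_ q (tape s) 1 cf ->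
  exists cf1 cf', [/\ step P cf = Some cf1, reach cf1 cf'
    & at_ q.+2 (tape s) 1 cf'].
Proof.
move=> ik /= [qr [qr1 _]] si hcf.
have [|cf1 s1 a1] := at_left qr hcf (tape_le _ _) (q' := q.+1) (w := tape s 1).
  by rewrite bit_tape // lt0n si.
have {}a1 : at_ q.+1 (tape s) 0 cf1.
  by apply: at_ext a1 => j; case: eqP => // ->.
by have [cf2 r2 a2] := go_home qr1 a1; exists cf1, cf2.
Qed.

Lemma test_false q i c s cf : i < k -> rows_at q (rows q (While i c)) ->
  s i = 0 -> at_ q (tape s) 1 cf ->
  exists2 cf', reach cf cf' & at_ (q + csize (While i c)) (tape s) 1 cf'.
Proof.
move=> ik [qr [_]] /rows_at_cat[_]; rewrite size_rows => -[_ [_ [qr1 _]]] si hcf.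
have [|cf1 s1 a1] := at_left qr hcf (tape_le _ _) (q' := (q.+2 + csize c).+2)
  (w := tape s 1).
  by rewrite bit_tape // si.
have {}a1 : at_ (q.+2 + csize c).+2 (tape s) 0 cf1.
  by apply: at_ext a1 => j; case: eqP => // ->.
have [cf2 r2 a2] := go_home qr1 a1.
exists cf2; first exact: reach_trans (reach_step s1) r2.
by rewrite /= (_ : q + _ = (q.+2 + csize c).+3) //; lia.
Qed.

Lemma jump_back q i c s cf : rows_at q (rows q (While i c)) ->
  at_ (q.+2 + csize c) (tape s) 1 cf ->
  exists2 cf', reach cf cf' & at_ q (tape s) 1 cf'.
Proof.
move=> [_ [_]] /rows_at_cat[_]; rewrite size_rows => -[qr [qr1 _]] hcf.
have [cf1 s1 a1] := at_left qr hcf (tape_le _ _) (q' := (q.+2 + csize c).+1)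
  (w := tape s 1) erefl.
have {}a1 : at_ (q.+2 + csize c).+1 (tape s) 0 cf1.
  by apply: at_ext a1 => j; case: eqP => // ->.
have [cf2 r2 a2] := go_home qr1 a1.
by exists cf2; first exact: reach_trans (reach_step s1) r2.
Qed.

(** By induction on the execution: each program step is simulated by sweeps of
    the head. *)
Lemma cmd_correct c s s' : exec c s s' -> forall q cf, width c <= k ->
  rows_at q (rows q c) -> at_ q (tape s) 1 cf ->
  exists2 cf', reach cf cf' & at_ (q + csize c) (tape s') 1 cf'.
Proof.
elim=> {c s s'} [i s s' ss'|i s s' ss'|c d s s1 s' _ IHc _ IHd
  |i c s s' si ss'|i c s s1 s' si _ IHc _ IHw] q cf wk Hr hcf.
- by rewrite [csize _]/= addn2; apply: inc_correct wk Hr ss' hcf.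
- by rewrite [csize _]/= addn3; apply: dec_correct wk Hr ss' hcf.
- move: wk Hr; rewrite /= geq_max => /andP[wc wd] /rows_at_cat[rc].
  rewrite size_rows => rd.
  have [cf1 r1 a1] := IHc _ _ wc rc hcf.
  have [cf2 r2 a2] := IHd _ _ wd rd a1.
  by exists cf2; [exact: reach_trans r1 r2 | rewrite [csize _]/= addnA].
- have ik : i < k by move: wk; rewrite /= geq_max => /andP[].
  have [cf1 r1 a1] := test_false ik Hr si hcf.
  by exists cf1 => //; apply: at_ext a1; apply: eq_tape => j.
- have := wk; rewrite /= geq_max => /andP[ik wc].
  have [cf1 [cf2 [s1' r2 a2]]] := test_true ik Hr si hcf.
  have rc : rows_at q.+2 (rows q.+2 c) by case: Hr => _ [_ /rows_at_cat[]].
  have [cf3 r3 a3] := IHc _ _ wc rc a2.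
  have [cf4 r4 a4] := jump_back Hr a3.
  have [cf5 r5 a5] := IHw _ _ wk Hr a4.
  exists cf5 => //; apply: reach_trans (reach_step s1') _.
  exact: reach_trans r2 (reach_trans r3 (reach_trans r4 r5)).
Qed.

Definition halts (cf : config) : Prop :=
  exists n cf', runTM n cf = Some cf' /\ step P cf' = None.

(** A halting loop reaches 0: each round takes at least one step off the
    remaining running time, so the induction is on this time. *)
Lemma while_halts c f q z cf : (forall x, runs c [:: x] [:: f x]) ->
  width (While 0 c) <= k -> rows_at q (rows q (While 0 c)) ->
  at_ q (tape (nth 0 [:: z])) 1 cf -> halts cf -> exists n, iter n f z = 0.
Proof.
move=> cf_ wk Hr hcf [n [cf' []]].
have := wk; rewrite /= geq_max => /andP[k0 wc].
have rc : rows_at q.+2 (rows q.+2 c) by case: Hr => _ [_ /rows_at_cat[]].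
elim/ltn_ind: n z cf hcf => n IH z cf hcf Hn stop.
have [->|z0] := eqVneq z 0; first by exists 0.
have [cf1 [cf2 [s1 r2 a2]]] := test_true k0 Hr (s := nth 0 [:: z]) z0 hcf.
have [cf3 r3 a3] := cmd_correct (cf_ z) wc rc a2.
have [cf4 r4 a4] := jump_back Hr a3.
have [m Hm] := reach_trans r2 (reach_trans r3 r4).
have Hm1 : runTM m.+1 cf = Some cf4 by rewrite runTMS s1.
have [mn Hmn] := runTM_le Hm1 Hn stop.
have [||//|j Hj] := IH (n - m.+1) _ _ _ a4; first by lia.
  exact: Hmn.
by exists j.+1; rewrite iterSr.
Qed.

End Tables.

(** * Indices depending on a parameter *)

(** The machine for the parameter c first walks left from the input, writing c
    times the symbol 3.  Its bits 0 and 1 are set, so the registers become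
    c + n and c when the input is n.  Its states are 0 for the start, 1 to
    [csize main] for the program, [exit_state] without instructions, and those
    above for the writing phase.  Only the writing instructions and the
    destination of the start depend on c. *)
Section Machine.

Variables (k : nat) (main : cmd).
Hypotheses (k2 : 1 < k) (wk : width main <= k).

Definition exit_state : nat := (csize main).+1.

Definition table_pairs : seq (nat * nat) :=
  (exit_state.+1, 0) ::
  [seq (q, x) | q <- iota 1 (csize main), x <- iota 0 (2 ^ k).+1].

Fixpoint write_pairs (c : nat) : seq (nat * nat) :=
  if c is c'.+1 then (exit_state.+2 + c', 0) :: write_pairs c' else table_pairs.

Definition pairs (c : nat) : seq (nat * nat) :=
  (0, 0) :: (0, 1) :: write_pairs c.

Definition delta (c : nat) (p : nat * nat) : nat * nat * bool :=
  if p.1 == 0 then (exit_state.+1 + c, p.2, false)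
  else if p.1 < exit_state then
    nth (fun x => (0, x, false)) (rows k 1 main) p.1.-1 p.2
  else if p.1 == exit_state.+1 then (1, 2 ^ k, true)
  else (p.1.-1, 3, false).

Definition code_instr (p : nat * nat) (t : nat * nat * bool) : nat :=
  code [:: p.1; p.2; t.1.1; t.1.2; t.2 : nat].

Definition index_of (c : nat) : nat :=
  code [seq code_instr p (delta c p) | p <- pairs c].

Let P c := machine_of_nat (index_of c).

Lemma machineE c : P c = [seq Instr p.1 p.2 (delta c p).1.1 (delta c p).1.2
                              (delta c p).2 | p <- pairs c].
Proof.
rewrite /P /machine_of_nat CodeSeq.codeK -map_comp; apply: eq_map => p /=.
by rewrite /instr_of_nat CodeSeq.codeK /=; case: (delta c p).2.
Qed.

(** All instructions for a state and a symbol are equal, hence repetitions in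
    the list of pairs are harmless. *)
Lemma filter_machine c q x :
  [seq t <- P c | (src t == q) && (read t == x)] =
  nseq (count_mem (q, x) (pairs c))
    (Instr q x (delta c (q, x)).1.1 (delta c (q, x)).1.2 (delta c (q, x)).2).
Proof.
rewrite machineE; elim: (pairs c) => //= -[q' x'] s IH /=.
by rewrite IH xpair_eqE; case: eqP => [->|] //=; case: eqP => [->|].
Qed.

Lemma step_machine c q l t : (q, head 0 t) \in pairs c ->
  step (P c) (Config q l t) = Some
    (let: (q', w, m) := delta c (q, head 0 t) in
     if m then Config q' (w :: l) (behead t)
     else Config q' (behead l) (head 0 l :: w :: behead t)).
Proof.
move=> qx; rewrite /step filter_machine.
move: qx; rewrite -has_pred1 has_count; case: (count_mem _ _) => //= _ _.
by case: (delta _ _) => -[].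
Qed.

Lemma mem_table c p : p \in table_pairs -> p \in pairs c.
Proof.
move=> pt; rewrite /pairs !inE; apply/orP; right; apply/orP; right.
by elim: c => //= c IH; rewrite inE IH orbT.
Qed.

Lemma mem_write c j : j < c -> (exit_state.+2 + j, 0) \in pairs c.
Proof.
move=> jc; rewrite /pairs !inE; apply/orP; right; apply/orP; right.
elim: c jc => //= c IH; rewrite ltnS leq_eqVlt inE => /orP[/eqP ->|/IH ->].
  by rewrite eqxx.
by rewrite orbT.
Qed.

Lemma exit_notin c x : (exit_state, x) \notin pairs c.
Proof.
suff nw : (exit_state, x) \notin write_pairs c.
  by rewrite /pairs 2!inE !xpair_eqE /= (negbTE nw).
elim: c => [|c IH] /=.
  rewrite inE xpair_eqE ltn_eqF //; apply/negP => /allpairsP[[a b] /= [ha _ [eq _]]].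
  by move: ha eq; rewrite mem_iota /exit_state; lia.
by rewrite inE xpair_eqE negb_or IH andbT (_ : exit_state == _ = false) //; lia.
Qed.

Lemma exit_halts c l t : step (P c) (Config exit_state l t) = None.
Proof.
by rewrite /step filter_machine (count_memPn (exit_notin c _)).
Qed.

Lemma machine_rows c : rows_at k (P c) 1 (rows k 1 main).
Proof.
apply: (@rows_at_nth _ _ (fun x => (0, x, false))) => j; rewrite size_rows => jc l t xM.
rewrite add1n step_machine; first by rewrite /delta /= ltnS jc.
apply: mem_table; rewrite inE; apply/orP; right.
by apply/allpairsP; exists (j.+1, head 0 t); split=> //; rewrite mem_iota.
Qed.

Lemma cell_input c n j : cell k (nth 0 [:: c + n; c]) j =
  if j < c then 3 else (j < c + n).
Proof.
rewrite /cell; case: k k2 => [|[|k']] //= _.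
rewrite (@enc_false k') => [|i]; last by rewrite nth_nil.
case: (ltnP j c) => jc; last by rewrite addn0.
by rewrite ltn_addr.
Qed.

(** With j symbols still to be written, the head is on a blank in front of the d
    symbols already written and the n symbols of the input. *)
Lemma write_counter c n j d r : c = j + d -> head 0 r = 0 ->
  (forall i, nth 0 r i.+1 = if i < d then 3 else (i < d + n)) ->
  exists2 cf, reach (P c) (Config (exit_state.+1 + j) [::] r) cf &
    at_ 1 (tape k (nth 0 [:: c + n; c])) 1 cf.
Proof.
elim: j d r => [|j IH] d r cE r0 rT.
  eexists.
    apply: reach_step; rewrite addn0 step_machine; last first.
      by rewrite r0; apply: mem_table; rewrite inE eqxx.
    by rewrite r0 /delta /= ltnNge leqnSn eqxx.
  split=> // i; rewrite add1n /= cell_input nth_behead cE; exact: rT.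
have jc : j < c by lia.
have [|//|[|i]|cf rc ac] := IH d.+1 (0 :: 3 :: behead r).
- by rewrite cE addSnnS.
- by [].
- by rewrite /= nth_behead rT.
exists cf => //; apply: reach_trans rc; apply: reach_step.
rewrite addnS -addSn step_machine ?r0 ?mem_write // /delta /=.
by rewrite ltnNge (_ : exit_state <= _) ?gtn_eqF //=; lia.
Qed.

Lemma prelude c n : exists2 cf, reach (P c) (Defs.init n) cf &
  at_ 1 (tape k (nth 0 [:: c + n; c])) 1 cf.
Proof.
have rT i : nth 0 (behead (nseq n 1)) i = (i.+1 < n).
  by rewrite nth_behead nth_nseq; case: ltnP.
have [[|i]|cf rc ac] := @write_counter c n c 0
    (0 :: head 0 (nseq n 1) :: behead (nseq n 1)) (esym (addn0 c)) erefl.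
- by rewrite /= add0n; case: (n).
- by rewrite /= rT add0n.
exists cf => //; apply: reach_trans rc; apply: reach_step.
rewrite step_machine //.
by case: (n) => [|m]; rewrite !inE.
Qed.

Lemma count_mem_unary y r : (forall j, nth 0 r j = (j < y)) -> count_mem 1 r = y.
Proof.
elim: r y => [|a r IH] y ry; first by case: y ry => // y /(_ 0).
rewrite /= (IH y.-1) => [|j]; last by have /= -> := ry j.+1; case: (y).
by have /= -> := ry 0; case: y {ry}.
Qed.

Lemma eval_main c n y : runs main [:: c + n; c] [:: y] -> eval (index_of c) n y.
Proof.
move=> run; have [cf1 r1 a1] := prelude c n.
have [cf2 r2 a2] := cmd_correct run wk (machine_rows c) a1.
have [m Hm] := reach_trans r1 r2; exists m, cf2; split=> //.
  case: cf2 a2 {r2 Hm} => q l t [/= -> _ _]; exact: exit_halts.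
case: a2 => _ lT rT; rewrite /output lT /= /rev /= (count_mem_unary (y := y)).
  by rewrite gtn_eqF // -{1}(expn0 2) ltn_exp2l // ltnW.
move=> j; rewrite rT add1n /= /cell; case: k k2 => // k' _ /=.
rewrite (@enc_false k') => [|i]; last by rewrite nth_nil.
by rewrite addn0.
Qed.

End Machine.

(** Raising c by one adds one instruction whose entries are affine in c, so the
    code of the list is built by recursion on c from a fixed code. *)
Lemma PR_index_of k main : PR (index_of k main).
Proof.
pose fixed := code [seq code_instr p (delta k main 0 p) | p <- table_pairs k main].
pose q := (exit_state main).+1.
apply: (@PR_ext (fun c =>
   consn (code [:: 0; 0; q + c; 0; 0]) (consn (code [:: 0; 1; q + c; 1; 0])
     (rec fixed (fun j acc => consn (code [:: q.+1 + j; 0; q + j; 3; 0]) acc) c))));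
  last by pr.
move=> c; rewrite /index_of /pairs 2!map_cons [RHS]code_cons
  [X in _ = consn _ X]code_cons.
have -> : fixed = code [seq code_instr p (delta k main c p) | p <- table_pairs k main].
  congr code; apply/eq_in_map => p; rewrite inE => /orP[/eqP -> //|].
  by case/allpairsP => -[a b] [ain _ ->]; move: ain; rewrite mem_iota; case: a.
congr (consn _ (consn _ _)); elim: {2 4}c => // j IH.
rewrite [LHS]/= IH [write_pairs _ _ _]/= map_cons [RHS]code_cons.
rewrite /code_instr /delta /= ltnNge (_ : exit_state main <= _) ?gtn_eqF ?addSn //=.
all: by rewrite /exit_state; lia.
Qed.

Theorem PR_computable f : PR f -> computable f.
Proof.
move=> /PR_cmd[main Hf].
exists (index_of (maxn 2 (width main)) main 0) => n.
apply: eval_main; rewrite ?leq_max ?leqnn ?orbT //.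
by apply: runs_ext (Hf n) => // -[|[|j]] //=; rewrite nth_nil.
Qed.

(** The machine iterates a step on (K, c, n) that increments K until the test
    succeeds and then returns 0: a loop that stops exactly at 0. *)
Theorem PR_search T : PR T -> exists p, PR p /\
  forall c n, Sigma01 (p c) n <-> exists K, T (consn c (consn n K)) != 0.
Proof.
move=> HT.
pose h z := if T (consn (hd (tl z)) (consn (tl (tl z)) (hd z))) == 0
  then consn (hd z).+1 (tl z) else 0.
have /PR_cmd[ch Hch] : PR h by rewrite /h; pr.
pose g x := consn 0 (consn (tl x) (hd x - tl x)).
have /PR_cmd[cg Hcg] : PR g by rewrite /g; pr.
have [prep run_prep] : exists prep, forall c n,
    runs prep [:: c + n; c] [:: consn 0 (consn c n)].
  exists (pour 1 [:: 2] ;; pour 0 [:: 1] ;; cons_cmd ;; cg) => c n.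
  run_step [:: c + n; 0; c]; run_step [:: 0; c + n; c].
  apply: runs_seq (runs_cons _ _) _.
  by have := Hcg (consn (c + n) c); rewrite /g hd_consn tl_consn addKn.
pose loop := While 0 ch.
pose main := prep ;; loop.
pose k := maxn 2 (width main).
have k2 : 1 < k by rewrite leq_max.
have wk : width main <= k by rewrite leq_max leqnn orbT.
exists (index_of k main); split=> [|c n]; first exact: PR_index_of.
split=> [[y [m [cf [Hm stop _]]]]|[K TK]].
  have [cf1 r1 a1] := prelude k2 wk c n.
  have [rp rl] : rows_at k (machine_of_nat (index_of k main c)) 1 (rows k 1 prep) /\
      rows_at k (machine_of_nat (index_of k main c)) (1 + csize prep)
        (rows k (1 + csize prep) loop).
    by have /rows_at_cat := machine_rows k main c; rewrite size_rows.
  have [wp wl] : width prep <= k /\ width loop <= k.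
    by split; apply: leq_trans wk; rewrite /= leq_max leqnn ?orbT.
  have [cf2 r2 a2] := cmd_correct (run_prep c n) wp rp a1.
  have [m2 Hm2] := reach_trans r1 r2.
  have [_ Hm3] := runTM_le Hm2 Hm stop.
  have [|j Hj] := while_halts Hch wl rl a2; first by exists (m - m2), cf.
  suff found i K : iter i h (consn K (consn c n)) = 0 ->
    exists K', T (consn c (consn n K')) != 0 by exact: found Hj.
  elim: i K => [|i IH] K.
    by move=> y0; have := consn_gt0 K (consn c n); rewrite (y0 : consn K _ = 0).
  rewrite iterSr {2}/h hd_consn tl_consn hd_consn tl_consn.
  by case: eqP => [_ /IH //|/eqP TK _]; exists K.
exists 0; apply: eval_main => //; apply: runs_seq (run_prep c n) _.
suff run_loop d K0 : K0 + d = K -> runs loop [:: consn K0 (consn c n)] [:: 0].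
  exact: run_loop (add0n K).
elim: d K0 => [|d IH] K0 K0d; apply: runs_loop (Hch _) _;
  rewrite -?lt0n ?consn_gt0 // /h hd_consn tl_consn hd_consn tl_consn.
  by rewrite -K0d addn0 in TK; rewrite (negbTE TK); apply: runs_exit.
case: eqP => [_|_]; last exact: runs_exit.
by apply: IH; rewrite addSnnS.
Qed.

(** * Bounded evaluation of machines *)

Definition code_config (cf : config) : nat :=
  code [:: state cf; code (lpart cf); code (rpart cf)].

(** 0 is not the code of a configuration and stands for a halted machine. *)
Definition code_step (e z : nat) : nat :=
  foldr (fun i acc =>
    if (arg i 0 == arg z 0) && (arg i 1 == hd (arg z 2)) then
      if arg i 4 == 0
      then code [:: arg i 2; tl (arg z 1);
                    consn (hd (arg z 1)) (consn (arg i 3) (tl (arg z 2)))]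
      else code [:: arg i 2; consn (arg i 3) (arg z 1); tl (arg z 2)]
    else acc) 0 (decode e).

Lemma code_stepE e cf : code_step e (code_config cf) =
  if step (machine_of_nat e) cf is Some cf' then code_config cf' else 0.
Proof.
case: cf => q l r; rewrite /code_step /step /machine_of_nat.
have [-> -> ->] : [/\ arg (code_config (Config q l r)) 0 = q,
    arg (code_config (Config q l r)) 1 = code l
  & arg (code_config (Config q l r)) 2 = code r] by rewrite /code_config CodeSeq.codeK.
rewrite !hd_code !tl_code; elim: (decode e) => //= i s ->; case: ifP => //= _.
by rewrite /code_config; case: eqP.
Qed.

Lemma code_config_gt0 cf : 0 < code_config cf.
Proof. exact: consn_gt0. Qed.

Definition code_run (e n k : nat) : nat :=
  iter k (fun z => if code_step e z == 0 then z else code_step e z)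
    (code [:: 0; 0; iter n (consn 1) 0]).

(** 0 while the machine e runs, the successor of the output once it has
    stopped within k steps. *)
Definition value (e n k : nat) : nat :=
  if code_step e (code_run e n k) == 0 then
    (count_mem 1 (decode (arg (code_run e n k) 1)) +
     count_mem 1 (decode (arg (code_run e n k) 2))).+1
  else 0.

Lemma PR_value e n k : PR e -> PR n -> PR k ->
  PR (fun x => value (e x) (n x) (k x)).
Proof. by rewrite /value /code_run /code_step => He Hn Hk; pr. Qed.

Definition run_on (M : machine) (k : nat) (cf : config) : config :=
  iter k (fun cf => odflt cf (step M cf)) cf.

Lemma code_runE e n k :
  code_run e n k = code_config (run_on (machine_of_nat e) k (Defs.init n)).
Proof.
rewrite /code_run /run_on; elim: k => [|k IH].
  rewrite /= /code_config /Defs.init /=; congr (code [:: _; _; _]).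
  by elim: n => //= n ->.
rewrite [LHS]iterS [in RHS]iterS IH code_stepE; case: (step _ _) => [cf'|] //.
by rewrite eqn0Ngt code_config_gt0.
Qed.

Lemma valueE e n k : value e n k =
  let cf := run_on (machine_of_nat e) k (Defs.init n) in
  if step (machine_of_nat e) cf is None then (output cf).+1 else 0.
Proof.
rewrite /value code_runE code_stepE /=; case: (step _ _) => [cf'|].
  by rewrite eqn0Ngt code_config_gt0.
by rewrite /code_config !CodeSeq.codeK.
Qed.

Lemma run_on_stop M k k' cf : step M (run_on M k cf) = None -> k <= k' ->
  run_on M k' cf = run_on M k cf.
Proof.
move=> stop /subnK <-; elim: (k' - k) => // d IH.
by rewrite addSn /run_on iterS -/(run_on M _ cf) IH stop.
Qed.

Lemma value_mono e n k k' : value e n k != 0 -> k <= k' ->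
  value e n k' = value e n k.
Proof.
rewrite !valueE /=; case Ec: (step _ _) => [//|] _ kk'.
by rewrite (run_on_stop Ec kk') Ec.
Qed.

Lemma run_on_iter M k cf cf' : iter k (obind (step M)) (Some cf) = Some cf' ->
  run_on M k cf = cf'.
Proof.
elim: k cf' => [|k IH] cf' /=; first by case.
by case E: (iter k _ _) => [cf1|] //= s1; rewrite (IH _ E) s1.
Qed.

(** Finitely many computations that all halt are finished at every late stage;
    this replaces explicit bounds on their running times. *)
Definition eventually (P : nat -> Prop) : Prop :=
  exists k0, forall k, k0 <= k -> P k.

Lemma eventually_and P Q : eventually P -> eventually Q ->
  eventually (fun k => P k /\ Q k).
Proof.
move=> [k0 H0] [k1 H1]; exists (maxn k0 k1) => k; rewrite geq_max => /andP[? ?].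
by split; auto.
Qed.

Lemma eventually_imp P Q : (forall k, P k -> Q k) -> eventually P -> eventually Q.
Proof. by move=> PQ [k0 H]; exists k0 => k /H /PQ. Qed.

Lemma eventually_all n P : (forall i, i < n -> eventually (P i)) ->
  eventually (fun k => forall i, i < n -> P i k).
Proof.
elim: n => [|n IH] H; first by exists 0.
have IH' : eventually (fun k => forall i, i < n -> P i k).
  by apply: IH => i lin; apply: H; apply: ltnW.
apply: eventually_imp (eventually_and IH' (H n (ltnSn n))) => k [Hk Hn] i.
by rewrite ltnS leq_eqVlt => /orP[/eqP ->|/Hk].
Qed.

Lemma eval_value e n m : eval e n m -> eventually (fun k => value e n k = m.+1).
Proof.
move=> [k [cf [Hk stop <-]]]; have E : value e n k = (output cf).+1.
  by rewrite valueE /= (run_on_iter Hk) stop.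
by exists k => k' kk'; rewrite (value_mono _ kk') E.
Qed.

Lemma eval_value_eq e n m k : eval e n m -> value e n k != 0 -> value e n k = m.+1.
Proof.
move=> /eval_value[k0 H0] Vk; rewrite -(value_mono Vk (leq_maxl k k0)).
by apply: H0; apply: leq_maxr.
Qed.

Lemma decides_value e A n : decides e A ->
  exists b : bool, [/\ A n <-> b, eventually (fun k => value e n k = b.+1)
    & forall k, value e n k != 0 -> value e n k = b.+1].
Proof.
move=> /(_ n)[b [eb Ab]]; exists b; split=> // [|k]; first exact: eval_value.
exact: eval_value_eq.
Qed.

(** * Folding over codes of formulas *)

(** Codes of subformulas are smaller than the code of the formula.  The table
    of the values below n is a coded list with the latest value first, so the
    value at y < n is its entry n - y - 1. *)
Definition table (h : nat -> nat -> nat) (n : nat) : nat :=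
  rec 0 (fun i t => consn (h i t) t) n.

Definition cov (h : nat -> nat -> nat) (n : nat) : nat := h n (table h n).

Notation entry t n y := (arg t (n - y.+1)).

Lemma entry_table h n y : y < n -> entry (table h n) n y = cov h y.
Proof.
elim: n => // n IH; rewrite ltnS leq_eqVlt /table /= decode_consn => /orP[/eqP ->|yn].
  by rewrite subnn.
by rewrite subSS -(subnSK yn) /=; apply: IH.
Qed.

Lemma PR_cov s n : PR n -> PR (fun p => s (tl (tl p)) (hd p) (hd (tl p))) ->
  PR (fun x => cov (s x) (n x)).
Proof.
move=> Hn Hs; rewrite /cov /table.
have H : PR (fun x => consn (n x) (consn (rec 0 (fun i t => consn (s x i t) t) (n x)) x)).
  pr; have Hq : PR (fun p => consn (hd p) (consn (hd (tl p)) (tl (tl p)))) by pr.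
  by apply: PR_ext (PR_comp Hs Hq) => p; rewrite !(hd_consn, tl_consn).
by apply: PR_ext (PR_comp Hs H) => p; rewrite !(hd_consn, tl_consn).
Qed.

Lemma arg_lt z i : 0 < z -> arg z i < z.
Proof.
move=> z0; have [iz|iz] := ltnP i (size (decode z)); last by rewrite nth_default.
by apply: (allP (CodeSeq.gtn_decode z)); apply: mem_nth.
Qed.

Lemma cov_args (h : nat -> nat -> nat -> nat) z : 0 < z ->
  let F := cov (fun z t => h z (entry t z (arg z 1)) (entry t z (arg z 2))) in
  F z = h z (F (arg z 1)) (F (arg z 2)).
Proof. by move=> z0 F; rewrite {1}/F /cov !entry_table ?arg_lt. Qed.

Definition code_in_range (K i : nat) : bool := (K == 0) || (i.+1 < K).

Lemma code_in_rangeE K i : code_in_range (code_range K) i = in_range K i.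
Proof. by case: K. Qed.

Notation is_var v := (v == code [:: hd v; arg v 1]).
Notation lookup xs vs v := (arg vs (index v (decode xs))).

(** The value at z from the values v1, v2 at its components: 0 if z is not a
    well-formed quantifier-free formula or some call has not finished after k
    steps, 1 for false, 2 for true.  Here t computes the types of the relation
    symbols, r decides the relations, and xs, vs are the coded variables and
    their values.  The tests z == code _ make sure that z has the exact shape of a
    formula code. *)
Definition truth_step (J I t r k xs vs z v1 v2 : nat) : nat :=
  if z == code [:: 0; arg z 1; arg z 2] then
    if [&& all (fun v => is_var v) (decode (arg z 2)), code_in_range I (arg z 1)
         & value t (arg z 1) k == (code [seq hd v | v <- decode (arg z 2)]).+1]
    then value r (code [:: code [seq lookup xs vs v | v <- decode (arg z 2)];
                           arg z 1]) k
    else 0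
  else if z == code [:: 1; arg z 1; arg z 2] then
    if [&& is_var (arg z 1), is_var (arg z 2), code_in_range J (hd (arg z 1))
         & hd (arg z 1) == hd (arg z 2)]
    then (lookup xs vs (arg z 1) == lookup xs vs (arg z 2)).+1 else 0
  else if z == code [:: 2] then 1
  else if z == code [:: 3; arg z 1] then
    if v1 == 0 then 0 else (v1 == 1).+1
  else if (v1 == 0) || (v2 == 0) then 0
  else if z == code [:: 4; arg z 1; arg z 2] then ((v1 == 2) && (v2 == 2)).+1
  else if z == code [:: 5; arg z 1; arg z 2] then ((v1 == 2) || (v2 == 2)).+1
  else if z == code [:: 6; arg z 1; arg z 2] then (~~ (v1 == 2) || (v2 == 2)).+1
  else 0.

Definition truth (J I t r k xs vs : nat) : nat -> nat :=
  cov (fun z w => truth_step J I t r k xs vs z (entry w z (arg z 1))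
                    (entry w z (arg z 2))).

(** Lists of coded variables; meaningful on quantifier-free formulas. *)
Definition free_step (z v1 v2 : nat) : nat :=
  if hd z == 0 then arg z 2
  else if hd z == 1 then code [:: arg z 1; arg z 2]
  else if hd z == 2 then 0
  else if hd z == 3 then v1
  else code (decode v1 ++ decode v2).

Definition free : nat -> nat :=
  cov (fun z w => free_step z (entry w z (arg z 1)) (entry w z (arg z 2))).

Definition typed (s k b ts : nat) : bool :=
  (size (decode b) == size (decode ts)) &&
  all (fun i => value s (code [:: arg b i; hd (arg ts i)]) k == 2)
    (iota 0 (size (decode ts))).

(** Within k steps it is verified that n codes a formula, a partition of its
    variables and a tuple a of the right type, and that b is a tuple of the right
    type that satisfies the formula together with a. *)
Definition solution (c n k b : nat) : bool :=
  let l := (value c 0 k).-1 in let m := (value c 1 k).-1 in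
  let z := arg n 0 in let X := arg n 1 in let Y := arg n 2 in let a := arg n 3 in
  [&& value c 0 k != 0, value c 1 k != 0, n == code [:: z; X; Y; a],
      uniq (decode X ++ decode Y),
      all (fun v => v \in decode (free z)) (decode X ++ decode Y),
      all (fun v => v \in decode X ++ decode Y) (decode (free z)),
      typed (arg m 1) k a X, typed (arg m 1) k b Y &
      truth (arg l 0) (arg l 1) (arg l 2) (arg m 2) k
        (code (decode X ++ decode Y)) (code (decode a ++ decode b)) z == 2].

Ltac prv := repeat
  (match goal with
   | |- PR (fun x => value (@?a x) (@?b x) (@?c x)) => refine (@PR_value a b c _ _ _)
   | |- PR (fun x => nat_of_bool (uniq (@?l x))) => refine (@PR_uniq l _)
   | _ => pr1
   end; cbv beta).

Lemma PR_truth J I t r k xs vs z : PR J -> PR I -> PR t -> PR r -> PR k ->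
  PR xs -> PR vs -> PR z ->
  PR (fun x => truth (J x) (I x) (t x) (r x) (k x) (xs x) (vs x) (z x)).
Proof.
move=> HJ HI Ht Hr Hk Hxs Hvs Hz; rewrite /truth /truth_step /code_in_range.
refine (@PR_cov (fun x z w => _) _ Hz _); cbv beta; prv.
Qed.

Lemma PR_free z : PR z -> PR (fun x => free (z x)).
Proof.
move=> Hz; rewrite /free /free_step.
refine (@PR_cov (fun _ z w => _) _ Hz _); cbv beta; prv.
Qed.

Lemma PR_typed s k b ts : PR s -> PR k -> PR b -> PR ts ->
  PR (fun x => typed (s x) (k x) (b x) (ts x)).
Proof. by move=> Hs Hk Hb Hts; rewrite /typed; prv. Qed.

Lemma PR_solution c n k b : PR c -> PR n -> PR k -> PR b ->
  PR (fun x => solution (c x) (n x) (k x) (b x)).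
Proof.
move=> Hc Hn Hk Hb; rewrite /solution /=; cbv zeta.
repeat (match goal with
   | |- PR (fun x => nat_of_bool (typed (@?a x) (@?b x) (@?c x) (@?d x))) =>
       refine (@PR_typed a b c d _ _ _ _)
   | |- PR (fun x => free (@?b x)) => refine (@PR_free b _)
   | |- PR (fun x => code (decode (@?b x))) => apply: (@PR_decode b)
   | |- PR (fun x => truth (@?a x) (@?b x) (@?c x) (@?d x) (@?e x) (@?f x) (@?g x) (@?h x)) =>
       refine (@PR_truth a b c d e f g h _ _ _ _ _ _ _ _)
   | _ => progress prv
   end; cbv beta).
Qed.

(** * Correctness of the evaluation *)

Lemma code_inj : injective code.
Proof. exact: can_inj CodeSeq.codeK. Qed.

Lemma code_eq s s' : (code s == code s') = (s == s').
Proof. exact: (can_eq CodeSeq.codeK). Qed.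

Lemma arg_code s i : arg (code s) i = nth 0 s i.
Proof. by rewrite CodeSeq.codeK. Qed.

Lemma code_var_inj : injective code_var.
Proof. by move=> [a b] [a' b'] /code_inj [-> ->]. Qed.

Lemma code_vars_inj : injective code_vars.
Proof. by move=> xs ys /code_inj; apply: inj_map code_var_inj _ _. Qed.

(** The list under the outermost coding, which exposes the tag to injectivity. *)
Definition form_list (f : form) : seq nat :=
  match f with
  | Atom i xs => [:: 0; i; code_vars xs]
  | Equal x y => [:: 1; code_var x; code_var y]
  | Falsum => [:: 2]
  | Neg f => [:: 3; code_form f]
  | And f g => [:: 4; code_form f; code_form g]
  | Or f g => [:: 5; code_form f; code_form g]
  | Imp f g => [:: 6; code_form f; code_form g]
  | All x f => [:: 7; code_var x; code_form f]
  | Ex x f => [:: 8; code_var x; code_form f]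
  end.

Lemma code_formE f : code_form f = code (form_list f).
Proof. by case: f. Qed.

Lemma code_form_inj : injective code_form.
Proof.
move=> f g; rewrite !code_formE => /code_inj.
elim: f g => [i xs|x y||f IHf|f IHf g IHg|f IHf g IHg|f IHf g IHg|x f IHf|x f IHf]
  [i' xs'|x' y'||f'|f' g'|f' g'|f' g'|x' f'|x' f'] //= [].
- by move=> -> /code_vars_inj ->.
- by move=> /code_var_inj -> /code_var_inj ->.
- by rewrite !code_formE => /code_inj/IHf ->.
- by rewrite !code_formE => /code_inj/IHf -> /code_inj/IHg ->.
- by rewrite !code_formE => /code_inj/IHf -> /code_inj/IHg ->.
- by rewrite !code_formE => /code_inj/IHf -> /code_inj/IHg ->.
- by rewrite !code_formE => /code_var_inj -> /code_inj/IHf ->.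
- by rewrite !code_formE => /code_var_inj -> /code_inj/IHf ->.
Qed.

Lemma code_gt0 a s : 0 < code (a :: s).
Proof. exact: consn_gt0. Qed.

Lemma is_var_code x : is_var (code_var x).
Proof. by rewrite /code_var /cpair hd_code arg_code. Qed.

Lemma all_is_var s : all (fun v => is_var v) s ->
  exists xs, s = [seq code_var x | x <- xs].
Proof.
move=> sv; exists [seq (hd v, arg v 1) | v <- s].
rewrite -map_comp -[LHS]map_id; apply/eq_in_map => v vs.
exact/eqP/(allP sv).
Qed.

Lemma decode_code_vars xs : decode (code_vars xs) = [seq code_var x | x <- xs].
Proof. exact: CodeSeq.codeK. Qed.

Lemma hd_code_var x : hd (code_var x) = x.1.
Proof. exact: hd_code. Qed.

Lemma map_hd_code_vars xs : [seq hd v | v <- decode (code_vars xs)] = [seq x.1 | x <- xs].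
Proof. by rewrite decode_code_vars -map_comp; apply: eq_map => x; apply: hd_code_var. Qed.

Lemma lookup_assign xs vs x :
  lookup (code_vars xs) (code vs) (code_var x) = assign xs vs x.
Proof. by rewrite decode_code_vars CodeSeq.codeK index_map //; apply: code_var_inj. Qed.

Lemma freeE z : 0 < z -> free z = free_step z (free (arg z 1)) (free (arg z 2)).
Proof. exact: cov_args. Qed.

Lemma free_form f : quantifier_free f -> free (code_form f) = code_vars (free_vars f).
Proof.
elim: f => // [i xs|x y|f IH|f IHf g IHg|f IHf g IHg|f IHf g IHg] qf;
  rewrite freeE ?code_gt0 // /free_step !hd_code /= ?arg_code //= ?IH //;
  by case/andP: qf => qf qg; rewrite IHf // IHg // !decode_code_vars -map_cat.
Qed.

Section Structure.

Variables (L : language) (M : structure L) (t s r : nat).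
Hypothesis t_types : forall i, in_range (rel_idx L) i -> eval t i (code (rel_type L i)).
Hypothesis s_sorts : decides s (fun n => exists a j, n = cpair a j /\ Defs.sort M j a).
Hypothesis r_rels :
  decides r (fun n => exists b i, n = cpair (code b) i /\ Defs.rel M i b).

Let J := code_range (sort_idx L).
Let I := code_range (rel_idx L).

Lemma truthE k xs vs z : 0 < z -> truth J I t r k xs vs z =
  truth_step J I t r k xs vs z (truth J I t r k xs vs (arg z 1))
    (truth J I t r k xs vs (arg z 2)).
Proof. exact: (cov_args (truth_step J I t r k xs vs)). Qed.

Lemma truth0 k xs vs : truth J I t r k xs vs 0 = 0.
Proof.
have n0 a w : (0 == code (a :: w)) = false by rewrite ltn_eqF ?code_gt0.
by rewrite /truth /cov /truth_step !n0 /= ?if_same.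
Qed.

(** Soundness of parsing: a finished evaluation exhibits a formula.  By strong
    induction on the code. *)
Lemma truth_form k xs vs z : truth J I t r k xs vs z != 0 ->
  exists f, [/\ z = code_form f, wf_form L f & quantifier_free f].
Proof.
elim/ltn_ind: z => z IH; have [->|z0] := posnP z; first by rewrite truth0.
have IH1 := IH _ (arg_lt 1 z0); have IH2 := IH _ (arg_lt 2 z0).
rewrite truthE // /truth_step; case: (z =P _) => [zE|_].
  case: ifP => // /and3P[/all_is_var[ys ysE]].
  rewrite /I code_in_rangeE => iI /eqP tE _.
  exists (Atom (arg z 1) ys); split=> //=.
    by rewrite {1}zE -[arg z 2]CodeSeq.decodeK ysE.
  have := eval_value_eq (t_types iI) (k := k); rewrite tE => /(_ isT) [/code_inj tyE].
  rewrite iI -tyE ysE -map_comp; apply/eqP/eq_map => x; exact/esym/hd_code_var.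
case: (z =P _) => [zE|_].
  case: ifP => // /and4P[/eqP v1 /eqP v2]; rewrite /J code_in_rangeE => jJ /eqP jE _.
  exists (Equal (hd (arg z 1), arg (arg z 1) 1) (hd (arg z 2), arg (arg z 2) 1)).
  split=> //=; last by rewrite jJ jE eqxx.
  by rewrite {1}zE {1}v1 {1}v2.
case: (z =P _) => [zE _|_]; first by exists Falsum.
case: (z =P _) => [zE|_].
  case: ifP => // /negbT /IH1[f [fE wf qf]] _.
  by exists (Neg f); split=> //; rewrite zE fE.
case: ifP => //; move/negbT; rewrite negb_or => /andP[/IH1[f [fE wf qf]] /IH2[g [gE wg qg]]].
case: (z =P _) => [zE _|_].
  by exists (And f g); rewrite /= wf wg qf qg zE fE gE.
case: (z =P _) => [zE _|_].
  by exists (Or f g); rewrite /= wf wg qf qg zE fE gE.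
case: (z =P _) => [zE _|//].
by exists (Imp f g); rewrite /= wf wg qf qg zE fE gE.
Qed.

(** A decision procedure observed over time: silent (0) at first, never wrong,
    and eventually answering 1 (false) or 2 (true). *)
Definition approximates (F : nat -> nat) (A : Prop) : Prop :=
  exists b : bool, [/\ A <-> b, eventually (fun k => F k = b.+1)
    & forall k, F k != 0 -> F k = b.+1].

(** A connective waits for both components, so the answers combine. *)
Lemma approx_bin (op : bool -> bool -> bool) F G H A B C :
  approximates F A -> approximates G B ->
  (forall a b : bool, (A <-> a) -> (B <-> b) -> (C <-> op a b)) ->
  (forall k, H k = if (F k == 0) || (G k == 0) then 0
                   else (op (F k == 2) (G k == 2)).+1) ->
  approximates H C.
Proof.
move=> [a [Aa evF Fa]] [b [Bb evG Gb]] opC HE.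
have b2 (x : bool) : (x.+1 == 2) = x by case: x.
exists (op a b); split; first exact: opC.
  by apply: eventually_imp (eventually_and evF evG) => k [Fk Gk]; rewrite HE Fk Gk !b2.
move=> k; rewrite HE; case: ifP => // /negbT; rewrite negb_or.
by case/andP=> /Fa -> /Gb ->; rewrite !b2.
Qed.

Lemma truth_sat xs vs f : wf_form L f -> quantifier_free f ->
  approximates (fun k => truth J I t r k (code_vars xs) (code vs) (code_form f))
    (sat M (assign xs vs) f).
Proof.
elim: f => // [i ys|x y||f IH|f IHf g IHg|f IHf g IHg|f IHf g IHg] wf qf.
- have /andP[iI /eqP tyE] := wf.
  pose n := cpair (code [seq assign xs vs y | y <- ys]) i.
  have HE k : truth J I t r k (code_vars xs) (code vs) (code_form (Atom i ys)) =
      if value t i k == (code (rel_type L i)).+1 then value r n k else 0.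
    rewrite truthE ?code_gt0 // /truth_step !arg_code code_eq /= eqxx.
    rewrite /I code_in_rangeE iI map_hd_code_vars tyE.
    have -> : all (fun v => is_var v) (decode (code_vars ys)).
      by rewrite decode_code_vars all_map; apply/allP => y _; apply: is_var_code.
    congr (if _ then value r (code [:: code _; _]) k else 0).
    rewrite (decode_code_vars ys) -map_comp; apply: eq_map => y; exact: lookup_assign.
  have [b [nb evb vb]] := decides_value n r_rels; exists b; split.
  + rewrite -nb /n; split=> [Ri|[b' [i' [/code_inj[/code_inj <- <-]]]]] //.
    by exists [seq assign xs vs y | y <- ys], i.
  + apply: eventually_imp (eventually_and evb (eval_value (t_types iI))) => k [Hb Ht].
    by rewrite HE Ht eqxx.
  + by move=> k; rewrite HE; case: ifP => // _; apply: vb.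
- have /andP[jJ /eqP jE] := wf.
  have HE k : truth J I t r k (code_vars xs) (code vs) (code_form (Equal x y)) =
      (assign xs vs x == assign xs vs y).+1.
    have a1 : arg (code_form (Equal x y)) 1 = code_var x := arg_code _ 1.
    have a2 : arg (code_form (Equal x y)) 2 = code_var y := arg_code _ 2.
    rewrite truthE ?code_gt0 // /truth_step a1 a2 !is_var_code !code_eq /= !eqxx.
    by rewrite /J code_in_rangeE !hd_code_var jJ jE eqxx !lookup_assign.
  exists (assign xs vs x == assign xs vs y); split=> [||k _]; last exact: HE.
    by rewrite /=; split=> /eqP.
  by exists 0 => k _; apply: HE.
- have HE k : truth J I t r k (code_vars xs) (code vs) (code_form Falsum) = 1.
    by rewrite truthE ?code_gt0 // /truth_step !arg_code !code_eq.
  by exists false; split=> //; exists 0 => k _; apply: HE.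
- have [b [nb evb vb]] := IH wf qf.
  have HE k : truth J I t r k (code_vars xs) (code vs) (code_form (Neg f)) =
      let v := truth J I t r k (code_vars xs) (code vs) (code_form f) in
      if v == 0 then 0 else (v == 1).+1.
    by rewrite truthE ?code_gt0 // /truth_step !arg_code !code_eq /= eqxx.
  exists (~~ b); split=> [||k]; first by rewrite /= nb; split=> /negP.
    by apply: eventually_imp evb => k Hk; rewrite HE /= Hk; case: (b).
  by rewrite HE /=; case: ifP => // /negbT /vb ->; case: (b).
- have /andP[wff wfg] := wf; have /andP[qff qfg] := qf.
  apply: (approx_bin (op := andb) (IHf wff qff) (IHg wfg qfg)).
    by move=> a b /= -> ->; split=> /andP.
  move=> k; rewrite truthE ?code_gt0 // /truth_step !arg_code !code_eq /= !eqxx.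
  by [].
- have /andP[wff wfg] := wf; have /andP[qff qfg] := qf.
  apply: (approx_bin (op := orb) (IHf wff qff) (IHg wfg qfg)).
    by move=> a b /= -> ->; split=> /orP.
  move=> k; rewrite truthE ?code_gt0 // /truth_step !arg_code !code_eq /= !eqxx.
  by [].
- have /andP[wff wfg] := wf; have /andP[qff qfg] := qf.
  apply: (approx_bin (op := fun a b => ~~ a || b) (IHf wff qff) (IHg wfg qfg)).
    by move=> a b /= -> ->; rewrite -implybE; split=> /implyP.
  move=> k; rewrite truthE ?code_gt0 // /truth_step !arg_code !code_eq /= !eqxx.
  by [].
Qed.

Lemma typed_of_type k b xs : typed s k b (code_vars xs) ->
  of_type (Defs.sort M) (decode b) [seq x.1 | x <- xs].
Proof.
rewrite /typed decode_code_vars size_map => /andP[/eqP sz /allP H].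
split=> [|i]; rewrite size_map // => ilt.
have /eqP V : value s (code [:: arg b i; hd (nth 0 [seq code_var x | x <- xs] i)]) k == 2.
  by apply: H; rewrite mem_iota.
have [[] [nb _ /(_ k)]] := decides_value
    (code [:: arg b i; hd (nth 0 [seq code_var x | x <- xs] i)]) s_sorts;
  rewrite V => // /(_ isT) // _.
have [a [j [/code_inj[-> hj] sj]]] := nb.2 isT.
by rewrite -hj in sj; move: sj; rewrite !(nth_map (0, 0)) // hd_code_var.
Qed.

Lemma of_type_typed b xs : of_type (Defs.sort M) b [seq x.1 | x <- xs] ->
  eventually (fun k => typed s k (code b) (code_vars xs)).
Proof.
case; rewrite size_map => sz H.
suff : eventually (fun k => forall i, i < size xs ->
    value s (code [:: arg (code b) i; hd (arg (code_vars xs) i)]) k = 2).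
  apply: eventually_imp => k Hk; rewrite /typed CodeSeq.codeK decode_code_vars.
  rewrite size_map sz eqxx; apply/allP => i; rewrite mem_iota /= => ilt.
  by rewrite -{1}[b]CodeSeq.codeK -decode_code_vars Hk.
apply: eventually_all => i ilt; have := H i ilt; rewrite (nth_map (0, 0)) // => si.
have [b' [nb ev _]] := decides_value
  (code [:: arg (code b) i; hd (arg (code_vars xs) i)]) s_sorts.
case: b' nb ev => [_ //|nb _].
have // : false.
apply/nb; do 2 eexists; split; first by [].
by rewrite decode_code_vars (nth_map (0, 0)) // hd_code_var CodeSeq.codeK.
Qed.

End Structure.

(** * The set as a difference of two searches *)

Definition solves (L : language) (M : structure L) (n : nat) (b : seq nat) : Prop :=
  exists f xs ys a,
    [/\ n = code [:: code_form f; code_vars xs; code_vars ys; code a],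
        wf_form L f /\ quantifier_free f,
        uniq (xs ++ ys) /\ xs ++ ys =i free_vars f,
        of_type (Defs.sort M) a [seq x.1 | x <- xs]
      & of_type (Defs.sort M) b [seq y.1 | y <- ys] /\
        sat M (assign (xs ++ ys) (a ++ b)) f].

(** Codes that occur among those of the free variables are codes of variables;
    this is how a coded partition is decoded. *)
Lemma code_vars_preimage l fs : {subset l <= [seq code_var x | x <- fs]} ->
  exists xs, l = [seq code_var x | x <- xs].
Proof.
move=> H; apply: all_is_var; apply/allP => v /H /mapP[x _ ->]; exact: is_var_code.
Qed.

Lemma mem_code_vars xs fs : xs =i fs ->
  [seq code_var x | x <- xs] =i [seq code_var x | x <- fs].
Proof.
by move=> xf v; apply/mapP/mapP => -[x]; [rewrite xf | rewrite -xf] => xin ->; exists x.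
Qed.

Lemma mem_code_vars_inj xs fs :
  [seq code_var x | x <- xs] =i [seq code_var x | x <- fs] -> xs =i fs.
Proof.
move=> xf x; rewrite -(mem_map code_var_inj) xf mem_map //; exact: code_var_inj.
Qed.

Lemma solution_sound c L (M : structure L) n k b :
  codes_structure c M -> solution c n k b -> solves M n (decode b).
Proof.
move=> [l [m [cl [t [lE Ht]] cm [u [s [r [mE _ Hs Hr]]]]]]].
rewrite /solution; case/and5P=> V0 V1 /eqP nE Hu /and5P[/allP sub1 /allP sub2 ta tb /eqP tr].
rewrite (eval_value_eq cl V0) (eval_value_eq cm V1) /= in ta tb tr.
rewrite lE mE !(arg_code [:: _; _; _]) /= in ta tb tr.
have [|f [fE wf qf]] := truth_form Ht (z := arg n 0) (k := k)
   (r := r) (xs := code (decode (arg n 1) ++ decode (arg n 2)))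
   (vs := code (decode (arg n 3) ++ decode b)).
  by rewrite tr.
rewrite fE free_form // decode_code_vars in sub1 sub2.
have [|xs xsE] := @code_vars_preimage (decode (arg n 1)) (free_vars f).
  by move=> v v1; apply: sub1; rewrite mem_cat v1.
have [|ys ysE] := @code_vars_preimage (decode (arg n 2)) (free_vars f).
  by move=> v v2; apply: sub1; rewrite mem_cat v2 orbT.
have XE : arg n 1 = code_vars xs by rewrite /code_vars -xsE CodeSeq.decodeK.
have YE : arg n 2 = code_vars ys by rewrite /code_vars -ysE CodeSeq.decodeK.
rewrite xsE ysE -map_cat in Hu sub1 sub2 tr.
rewrite XE in ta; rewrite YE in tb; rewrite fE in tr.
exists f, xs, ys, (decode (arg n 3)); split=> //.
- by rewrite {1}nE fE XE YE CodeSeq.decodeK.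
- split; first by rewrite -(map_inj_uniq code_var_inj).
  by apply: mem_code_vars_inj => v; apply/idP/idP => [/sub1|/sub2].
- exact: typed_of_type Hs _ _ _ ta.
- split; first exact: typed_of_type Hs _ _ _ tb.
  have [d [-> _ /(_ k)]] := truth_sat Ht Hr (xs ++ ys) (decode (arg n 3) ++ decode b) wf qf.
  by rewrite /code_vars tr => /(_ isT); case: d.
Qed.

Lemma solution_complete c L (M : structure L) n b :
  codes_structure c M -> solves M n b ->
  eventually (fun k => solution c n k (code b)).
Proof.
move=> [l [m [cl [t [lE Ht]] cm [u [s [r [mE _ Hs Hr]]]]]]].
move=> [f [xs [ys [a [nE [wf qf] [Hu Hf] ta [tb satb]]]]]].
have [d [nd evd _]] := truth_sat Ht Hr (xs ++ ys) (a ++ b) wf qf.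
have {nd}dT : d by apply/nd.
have ev := eventually_and (eventually_and (eval_value cl) (eval_value cm))
  (eventually_and evd (eventually_and (of_type_typed Hs ta) (of_type_typed Hs tb))).
apply: eventually_imp ev => k [[V0 V1] [tr [tka tkb]]].
rewrite /solution V0 V1 /= lE mE nE !(arg_code [:: _; _; _]) !(arg_code [:: _; _; _; _]) /=.
rewrite eqxx free_form // !decode_code_vars !CodeSeq.codeK -map_cat.
rewrite map_inj_uniq ?Hu ?tka ?tkb; last exact: code_var_inj.
rewrite /code_vars in tr *; rewrite tr dT /= andbT.
by apply/andP; split; apply/allP => v; rewrite (mem_code_vars Hf).
Qed.

(** The coding is injective, so all solutions of n refer to the same formula,
    partition and tuple a; unique existence therefore splits into existence and
    the absence of two distinct solutions. *)
Lemma dcl_solves L (M : structure L) n :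
  (exists f xs ys a, n = code [:: code_form f; code_vars xs; code_vars ys; code a] /\
     dcl_pair M f xs ys a) <->
  (exists b, solves M n b) /\
  ~ (exists b b', [/\ b <> b', solves M n b & solves M n b']).
Proof.
split.
  move=> [f [xs [ys [a [nE [wq uf ta [b [[tb sb] ub]]]]]]]].
  have solvesE b' : solves M n b' -> b = b'.
    move=> [f' [xs' [ys' [a' [nE' _ _ _ [tb' sb']]]]]].
    move: nE'; rewrite nE => /code_inj[/code_form_inj ff' /code_vars_inj xx'
      /code_vars_inj yy' /code_inj aa'].
    by apply: ub; rewrite ff' xx' yy' aa'.
  split; first by exists b, f, xs, ys, a.
  by move=> [b1 [b2 [b12 /solvesE b1E /solvesE b2E]]]; case: b12; rewrite -b1E -b2E.
move=> [[b sb] uniq_b]; have [f [xs [ys [a [nE wq uf ta [tb satb]]]]]] := sb.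
exists f, xs, ys, a; split=> //; split=> //; exists b; split=> // b' [tb' satb'].
have sb' : solves M n b' by exists f, xs, ys, a.
have [//|bb'] := eqVneq b b'.
by case: uniq_b; exists b, b'; split=> //; apply/eqP.
Qed.

(** K packs the number of steps and the candidate solutions. *)
Definition has_solution (c n K : nat) : bool := solution c n (arg K 0) (arg K 1).

Definition two_solutions (c n K : nat) : bool :=
  [&& arg K 1 != arg K 2, solution c n (arg K 0) (arg K 1)
    & solution c n (arg K 0) (arg K 2)].

Lemma has_solutionP c L (M : structure L) n : codes_structure c M ->
  (exists K, has_solution c n K) <-> exists b, solves M n b.
Proof.
move=> cM; split=> [[K /(solution_sound cM) ?]|[b /(solution_complete cM)[k Hk]]].
  by eexists; eassumption.
by exists (code [:: k; code b]); rewrite /has_solution !arg_code; apply: Hk.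
Qed.

Lemma two_solutionsP c L (M : structure L) n : codes_structure c M ->
  (exists K, two_solutions c n K) <->
  exists b b', [/\ b <> b', solves M n b & solves M n b'].
Proof.
move=> cM; split.
  move=> [K /and3P[/eqP d /(solution_sound cM) s1 /(solution_sound cM) s2]].
  by do 2 eexists; split; [|exact: s1|exact: s2] => /(can_inj CodeSeq.decodeK).
move=> [b [b' [bb' /(solution_complete cM) e1 /(solution_complete cM) e2]]].
have [k /(_ k (leqnn k)) [s1 s2]] := eventually_and e1 e2.
exists (code [:: k; code b; code b']); rewrite /two_solutions !arg_code /= s1 s2 !andbT.
by apply/eqP => /code_inj.
Qed.

(** The tests depend on c alone; the language and structure named by c enter
    only in the verification, where any of them may be used. *)
Lemma DCL0_tests c n : CompStr c ->
  DCL0 c n <-> (exists K, has_solution c n K) /\ ~ (exists K, two_solutions c n K).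
Proof.
move=> [L [M cM]]; split.
  move=> [L' [M' [cM' /dcl_solves[]]]].
  by rewrite -(has_solutionP n cM') -(two_solutionsP n cM').
rewrite (has_solutionP n cM) (two_solutionsP n cM) => H.
by exists L, M; split=> //; apply/dcl_solves.
Qed.

Lemma PR_has_solution c n K : PR c -> PR n -> PR K ->
  PR (fun x => has_solution (c x) (n x) (K x)).
Proof. by move=> Hc Hn HK; apply: PR_solution => //; pr. Qed.

Lemma PR_two_solutions c n K : PR c -> PR n -> PR K ->
  PR (fun x => two_solutions (c x) (n x) (K x)).
Proof.
move=> Hc Hn HK; rewrite /two_solutions.
apply: PR_and; first by pr.
by apply: PR_and; apply: PR_solution => //; pr.
Qed.

Lemma search_index (T : nat -> nat -> nat -> bool) :
  PR (fun x => T (hd x) (hd (tl x)) (tl (tl x))) ->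
  exists p, computable p /\ forall c n, Sigma01 (p c) n <-> exists K, T c n K.
Proof.
move=> /PR_search[p [Hp pT]]; exists p; split=> [|c n]; first exact: PR_computable.
rewrite pT; split=> -[K TK]; exists K; move: TK; rewrite ?(hd_consn, tl_consn);
  by case: (T c n K).
Qed.

Theorem proposition3p2 :
  (exists p s : nat -> nat,
     [/\ computable p, computable s
       & forall c, CompStr c -> forall n,
           DCL0 c n <-> Pi01 (p c) n /\ Sigma01 (s c) n]) /\
  (exists s p : nat -> nat,
     [/\ computable s, computable p
       & forall c, CompStr c ->
           (forall n, DCL0 c n <-> Sigma02 (s c) n) /\
           (forall n, DCL0 c n <-> Pi02 (p c) n)]).
Proof.
have PRc : PR (fun x => hd x) by pr.
have PRn : PR (fun x => hd (tl x)) by pr.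
have PRK : PR (fun x => tl (tl x)) by pr.
split.
  have [p [Hp pE]] := search_index (PR_two_solutions PRc PRn PRK).
  have [s [Hs sE]] := search_index (PR_has_solution PRc PRn PRK).
  exists p, s; split=> // c cC n; rewrite (DCL0_tests n cC) /Pi01 pE sE.
  by split=> -[].
(* Refutes that the number x paired with n is a witness of a unique
   solution; if it is one, no K is found. *)
pose T3 c nx K := ~~ has_solution c (arg nx 0) (arg nx 1) || two_solutions c (arg nx 0) K.
(* The number 0 claims that nothing solves n, and x + 1 claims that x contains
   two distinct solutions; the search refutes the claim. *)
pose T4 c nx K := (arg nx 1 == 0) && has_solution c (arg nx 0) K ||
  ~~ ((arg nx 1 == 0) || two_solutions c (arg nx 0) (arg nx 1).-1).
have [|s [Hs sE]] := @search_index T3.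
  apply: PR_or; last by apply: PR_two_solutions => //; pr.
  by apply: PR_not; apply: PR_has_solution => //; pr.
have [|p [Hp pE]] := @search_index T4.
  apply: PR_or; [apply: PR_and | apply: PR_not; apply: PR_or]; try by pr.
    by apply: PR_has_solution => //; pr.
  by apply: PR_two_solutions => //; pr.
exists s, p; split=> // c cC; split=> n; rewrite (DCL0_tests n cC).
  rewrite /Sigma02 /Pi01; split.
    move=> [[x Hx] no2]; exists x; rewrite sE => -[K].
    rewrite /T3 !arg_code /= Hx /= => H2; by case: no2; exists K.
  move=> [x]; rewrite sE => Hx; split.
    exists x; apply/negPn/negP => nx; case: Hx; exists 0.
    by rewrite /T3 !arg_code /= nx.
  by move=> [K HK]; case: Hx; exists K; rewrite /T3 !arg_code /= HK orbT.
rewrite /Pi02 /Sigma02 /Pi01; split.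
  move=> [[K HK] no2] [x]; apply; rewrite pE /T4.
  rewrite !arg_code /=; case: x => [|x] /=; first by exists K; rewrite HK.
  by exists 0; apply/negP => H2; case: no2; exists x.
move=> H; split.
  (* If nothing solved n, the claim made by 0 would be irrefutable. *)
  apply: NNPP => no; apply: H; exists 0; rewrite pE => -[K].
  by rewrite /T4 !arg_code /= orbF => HK; case: no; exists K.
move=> [K HK]; apply: H; exists K.+1; rewrite pE => -[K'].
by rewrite /T4 !arg_code /= HK.
Qed.
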